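(* Let $N\ge2$. Fix parameters $p,q$ with $q\ge p>N-1$ and a deterministic starting point $x\in C_N^B$. Consider the associated diffusions $(\widetilde X_{t,\kappa})_{t\ge0}$ started in $x$ for $\kappa\in\,]0,\infty[$ (with $p\ge N-1+\frac1{2\kappa}$). Then there are coefficients $a_{n,l}\in\mathbb R$ for $0\le l\le n\le N$ such that for all $t\ge0$ and $n=0,\ldots,N$ $$\mathbb E\bigl(e_n(\cosh(\widetilde X_{t,\kappa}))\bigr)=\sum_{l=0}^na_{n,l}\,e^{r_lt},\qquad r_l=l(p+q-l+1)\ (\text{so } r_0=0),$$ where the coefficients $a_{n,l}$ and the exponents $r_l$ depend on $p,q$ and $x$ only and not on $\kappa$. The same holds (with the same coefficients) for $\kappa=\infty$ and starting points $x$ in the interior of $C_N^B$.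
   Context: $e_n$ is the $n$-th elementary symmetric polynomial in $N$ variables and $\cosh(x):=(\cosh x_1,\ldots,\cosh x_N)$. $C_N^B=\{x\in\mathbb R^N:x_1\ge\ldots\ge x_N\ge0\}$. The parameters satisfy $\kappa>0$, $q\ge p\ge N-1+\frac1{2\kappa}$, and $k_{0,2}=p-(N-1)-\frac1{2\kappa}\ge 0$. For finite $\kappa$, $(\widetilde X_{t,\kappa})_{t\ge0}$ is the diffusion on $C_N^B$ with continuous paths, reflected at the boundary, with generator $$\widetilde L_\kappa=\frac1\kappa\Delta+\sum_{i=1}^N\Bigl((q-p)\coth\tfrac{x_i}2+2k_{0,2}\coth x_i+\sum_{j\ne i}\bigl(\coth\tfrac{x_i-x_j}2+\coth\tfrac{x_i+x_j}2\bigr)\Bigr)\partial_i$$ acting on functions invariant under the hyperoctahedral group (the non-compact Heckman-Opdam Laplacian of type $BC_N$ with multiplicities $\kappa(q-p),\kappa k_{0,2},\kappa$ on the roots $\pm e_i,\pm2e_i,\pm(e_i\pm e_j)$, divided by $\kappa$); it may be regarded as the solution of the SDE with diffusion part $\frac{\sqrt2}{\sqrt\kappa}dB_{t,j}$ ($B$ an $N$-dimensional Brownian motion) and the drift given by the coefficients of $\partial_j$ above. For $\kappa=\infty$, $\widetilde X_{t,\infty}$ is the deterministic solution of $$\frac{dx_j}{dt}(t)=\sum_{l\ne j}\Bigl(\coth\tfrac{x_j(t)-x_l(t)}2+\coth\tfrac{x_j(t)+x_l(t)}2\Bigr)+(q-p)\coth\tfrac{x_j(t)}2+2(p-(N-1))\coth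 x_j(t)\quad(j=1,\ldots,N),$$ which for initial data in the interior of $C_N^B$ exists for all $t\ge0$ in the interior. *)

(* Defs.v *)
From HB Require Import structures.
From mathcomp Require Import all_boot all_order all_algebra all_fingroup.
From mathcomp Require Import all_classical all_reals all_analysis.
Set Implicit Arguments.
Unset Strict Implicit.
Unset Printing Implicit Defensive.
Import Order.TTheory GRing.Theory Num.Theory.
Import numFieldNormedType.Exports.
Local Open Scope classical_set_scope.
Local Open Scope ring_scope.

Section HeckmanOpdamBC.
Context {R : realType}.

Definition cosh (x : R) : R := (expR x + expR (- x)) / 2.
Definition sinh (x : R) : R := (expR x - expR (- x)) / 2.

(* Junk value at the pole: coth 0 = 0. *)
Definition coth (x : R) : R := cosh x / sinh x.

Definition elem_sym (N n : nat) (x : 'rV[R]_N) : R :=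
  \sum_(h : {set 'I_N} | #|h| == n) \prod_(i in h) x 0 i.

Definition cosh_vec (N : nat) (x : 'rV[R]_N) : 'rV[R]_N := map_mx cosh x.

Definition chamberB {N : nat} : set 'rV[R]_N :=
  [set x | (forall i j : 'I_N, (i <= j)%N -> x 0 j <= x 0 i) /\
           (forall i : 'I_N, 0 <= x 0 i)].

Definition drift (N : nat) (p q k : R) (x : 'rV[R]_N) (i : 'I_N) : R :=
  (q - p) * coth (x 0 i / 2) + 2 * k * coth (x 0 i)
  + \sum_(j < N | j != i)
      (coth ((x 0 i - x 0 j) / 2) + coth ((x 0 i + x 0 j) / 2)).

Definition k02 (N : nat) (p kappa : R) : R :=
  p - (N%:R - 1) - (2 * kappa)^-1.

Definition partial (N : nat) (i : 'I_N) (f : 'rV[R]_N -> R) : 'rV[R]_N -> R :=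
  fun x => 'D_(delta_mx 0 i) f x.

(* On the walls of the chamber this expression involves the junk value of coth;
   it is only ever used in the interior (see [in_generator]). *)
Definition generator (N : nat) (p q kappa : R) (f : 'rV[R]_N -> R)
    (x : 'rV[R]_N) : R :=
  kappa^-1 * (\sum_(i < N) partial i (partial i f) x)
  + \sum_(i < N) drift p q (k02 N p kappa) x i * partial i f x.

Definition is_C2 (N : nat) (f : 'rV[R]_N -> R) : Prop :=
  [/\ continuous f,
      forall i x, derivable f x (delta_mx 0 i),
      forall i, continuous (partial i f),
      forall i j x, derivable (partial i f) x (delta_mx 0 j) &
      forall i j, continuous (partial j (partial i f))].

Definition hyperoctahedral_invariant (N : nat) (f : 'rV[R]_N -> R) : Prop :=
  forall (s : 'S_N) (eps : 'I_N -> bool) (x : 'rV[R]_N),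
    f (\row_i ((-1) ^+ eps i * x 0 (s i))) = f x.

(* Graph of the generator on its core of invariant test functions. For f
   invariant and C^2 the poles of the drift on the walls cancel against the
   zeros of the derivatives of f, so that the generator applied to f, defined
   in the interior, has a unique continuous extension g to the closed chamber.
   The invariance of f encodes the reflection at the walls. *)
Definition in_generator (N : nat) (p q kappa : R) (f g : 'rV[R]_N -> R) : Prop :=
  [/\ is_C2 f,
      compact (closure [set x | f x != 0]),
      hyperoctahedral_invariant f,
      {within chamberB, continuous g} &
      forall x, chamberB° x -> g x = generator p q kappa f x].

Section Processes.
Context {d : measure_display} {T : measurableType d}.

Definition natural_filtration (N : nat) (X : R -> T -> 'rV[R]_N) (t : R) :
    set (set T) :=
  <<s [set A | exists s : R, exists i : 'I_N, exists2 B : set R,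
         0 <= s <= t /\ measurable B & A = (fun w => X s w 0 i) @^-1` B] >>.

(* The last condition is E[M_t | F_s] = M_s, written out. *)
Definition martingale (P : probability T R) (F : R -> set (set T))
    (M : R -> T -> R) : Prop :=
  [/\ forall t : R, 0 <= t -> forall B : set R, measurable B -> F t (M t @^-1` B),
      forall t : R, 0 <= t -> P.-integrable setT (EFin \o M t) &
      forall s t : R, 0 <= s <= t -> forall A, F s A ->
        (\int[P]_(w in A) (M t w)%:E = \int[P]_(w in A) (M s w)%:E)%E].

(* The diffusion with the above generator started in x, as a solution of the
   martingale problem; only times t >= 0 are constrained. *)
Definition is_diffusion (N : nat) (p q kappa : R) (x : 'rV[R]_N)
    (P : probability T R) (X : R -> T -> 'rV[R]_N) : Prop :=
  [/\ forall (t : R) (i : 'I_N), 0 <= t -> measurable_fun setT (fun w => X t w 0 i),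
      forall w, {within `[0, +oo[, continuous (fun t => X t w)},
      forall (t : R) (w : T), 0 <= t -> chamberB (X t w),
      forall w, X 0 w = x &
      forall f g, in_generator p q kappa f g ->
        martingale P (natural_filtration X)
          (fun t w => f (X t w) - f (X 0 w)
             - \int[lebesgue_measure]_(s in `[0, t]) g (X s w))].

End Processes.

(* The flow for kappa = oo. The equation at t = 0, where the derivative is
   one-sided, follows from the one for t > 0 by continuity. *)
Definition is_frozen_flow (N : nat) (p q : R) (x : 'rV[R]_N)
    (y : R -> 'rV[R]_N) : Prop :=
  [/\ y 0 = x,
      {within `[0, +oo[, continuous y},
      forall t : R, 0 <= t -> chamberB° (y t) &
      forall (t : R) (j : 'I_N), 0 < t ->
        is_derive t 1 (fun s => y s 0 j) (drift p q (p - (N%:R - 1)) (y t) j)].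

Definition rate (p q : R) (l : nat) : R := l%:R * (p + q - l%:R + 1).

End HeckmanOpdamBC.

(* Main.v *)
Require Import Defs.
From HB Require Import structures.
From mathcomp Require Import all_boot all_order all_algebra.
From mathcomp Require Import all_classical all_reals all_analysis.
From mathcomp Require Import measurable_realfun ring lra.
Import Order.TTheory GRing.Theory Num.Theory.
Import numFieldNormedType.Exports.
Local Open Scope classical_set_scope.
Local Open Scope ring_scope.

(** In the coordinates z_i = cosh x_i, each coth of the drift times sinh x_i becomes rational with
    only z_i - z_j in denominators, and symmetrising in (i, j) divides these out. All degrees are
    treated at once through P(X) = prod_i (1 + z_i X): the sums over i become expressions in P, P'
    and P'', whose coefficients give r_n and the couplings to E_{n-1} and E_{n-2}.

    The obstacle is integrability: the martingale problem speaks only of compactly supported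
    functions, whereas L U <= C U concerns the unbounded U. Coefficients at least 1 make U dominate
    every E_m occurring in L U. Since grad U is only O(U), the second order term is of order phi_m''
    U^2, so the cutoff needs phi_m''(v) = O(1/v) uniformly in m; a cubed positive part achieves this
    and is still C^2. *)

(* Put E_n = e_n(cosh x). Since E_n is affine in each cosh x_i, the second order
   part of the generator acts on it as multiplication by n/kappa, and this cancels
   the kappa-dependent part of the drift: L E_n = r_n E_n + (lower E_m), with
   coefficients depending on p, q and N only. Hence the moments E[E_n(X_t)] and the
   values E_n(y(t)) of the frozen flow satisfy one and the same triangular linear
   system, whose diagonal entries r_0, ..., r_N are distinct; its solution is a
   combination of the exponentials e^{r_l t}.

   The E_n are not admissible test functions. For U a combination of the E_n with
   coefficients at least 1, the martingale property is applied to phi_m(U), with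
   phi_m a concave C^2 truncation of the identity that is constant from m on.
   Concavity gives L phi_m(U) <= C phi_m(U), so Gronwall and Fatou bound
   E[U(X_t)]. Moreover |phi_m''| (grad U)^2 is at most a constant times U and tends
   to 0 as m grows, so that dominated convergence by U yields Dynkin's formula
   for U. *)

Set Implicit Arguments.
Unset Strict Implicit.

(** * The generator on elementary symmetric polynomials *)

Section Algebra.

Lemma deriv_prod_set (R : comNzRingType) (I : finType) (A : {set I})
    (F : I -> {poly R}) :
  (\prod_(i in A) F i)^`() = \sum_(i in A) (F i)^`() * \prod_(k in A | k != i) F k.
Proof.
have [m] := ubnP #|A|; elim: m A => // m IH A.
have [->|[a aA]] := set_0Vmem A; first by rewrite !big_set0 derivC.
rewrite (cardsD1 a) aA ltnS => leAm.
rewrite (big_setD1 a aA) /= derivM IH // [RHS](big_setD1 a aA) /=; congr (_ * _ + _).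
  by apply: eq_bigl => k; rewrite !inE andbC.
rewrite big_distrr /=; apply: eq_bigr => i; rewrite !inE => /andP[ia iA].
rewrite [X in _ = _ * X](bigD1 a) /= ?aA 1?eq_sym // mulrCA; congr (_ * (_ * _)).
by apply: eq_bigl => k; rewrite !inE; case: (k == a); rewrite ?andbF ?andbT.
Qed.

Variables (R : realType) (N : nat).
Implicit Type z : 'rV[R]_N.

(* The partial derivative of [elem_sym n] in the i-th coordinate. *)
Definition elem_sym_der (i : 'I_N) (n : nat) z : R :=
  \sum_(h : {set 'I_N} | (#|h| == n) && (i \in h)) \prod_(k in h | k != i) z 0 k.

(** Expanding the product, [h] is the set of factors that contribute their X-term, so its cardinal
    is the degree. Arbitrary [a] and [b] are allowed because a factor X + 0 serves to force an index
    into [h]. *)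
Lemma coef_prod_linear (a b : 'I_N -> R) (n : nat) :
  (\prod_i ((a i)%:P * 'X + (b i)%:P))`_n
  = \sum_(h : {set 'I_N} | #|h| == n) (\prod_(i in h) a i) * \prod_(i | i \notin h) b i.
Proof.
rewrite (bigA_distr 1 (+%R)) coef_sum [RHS]big_mkcond /=; apply: eq_bigr => h _.
rewrite (bigID (mem h)) /=.
rewrite (eq_bigr (fun i => (a i)%:P * 'X)); last by move=> i ->.
rewrite [X in _ * X](eq_bigr (fun i => (b i)%:P)); last by move=> i /negbTE ->.
rewrite big_split /= prodr_const -!rmorph_prod /= mulrAC -polyCM coefCM coefXn.
by rewrite eq_sym; case: eqP; rewrite ?mulr1 ?mulr0.
Qed.

Definition gen_poly z : {poly R} := \prod_i ((z 0 i)%:P * 'X + 1).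

Definition gen_poly_wo (i : 'I_N) z : {poly R} :=
  \prod_(k | k != i) ((z 0 k)%:P * 'X + 1).

Lemma coef_gen_poly z n : (gen_poly z)`_n = elem_sym n z.
Proof.
rewrite /gen_poly /elem_sym (coef_prod_linear (fun i => z 0 i) (fun=> 1)).
by apply: eq_bigr => h _; rewrite [X in _ * X]big1_eq mulr1.
Qed.

Lemma coef_gen_poly_wo i z n : ('X * gen_poly_wo i z)`_n = elem_sym_der i n z.
Proof.
(* The extra X takes the place of the i-th factor as 1 * X + 0; its zero constant term kills every
   set that omits i. *)
have -> : 'X * gen_poly_wo i z =
    \prod_k ((if k == i then 1 else z 0 k)%:P * 'X + (k != i)%:R%:P).
  rewrite [RHS](bigD1 i) //= eqxx mul1r addr0; congr (_ * _).
  by apply: eq_bigr => k /negbTE ki; rewrite ki.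
rewrite coef_prod_linear /elem_sym_der [RHS]big_mkcondr /=; apply: eq_bigr => h _.
case: ifP => ih.
  rewrite [X in _ * X]big1 ?mulr1; last first.
    by move=> k kh; case: eqP kh => // ->; rewrite ih.
  rewrite (bigD1 i) //= eqxx mul1r; apply: eq_bigr => k /andP[_ /negbTE ->] //.
by rewrite [X in _ * X](bigD1 i) ?ih //= eqxx mul0r mulr0.
Qed.

Lemma deriv_gen_poly z : (gen_poly z)^`() = \sum_i (z 0 i)%:P * gen_poly_wo i z.
Proof.
rewrite /gen_poly; transitivity
  ((\prod_(i in [set: 'I_N]%SET) ((z 0 i)%:P * 'X + 1))^`()).
  by congr (_^`()); apply: eq_bigl => i; rewrite inE.
rewrite deriv_prod_set; apply: eq_big => i; first by rewrite inE.
move=> _; rewrite derivD derivM derivC derivX mul0r add0r mulr1 derivC addr0.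
by congr (_ * _); apply: eq_bigl => k; rewrite inE.
Qed.

Definition gen_poly_wo2 (i j : 'I_N) z : {poly R} :=
  \prod_(k | (k != i) && (k != j)) ((z 0 k)%:P * 'X + 1).

Lemma gen_poly_wo2C i j z : gen_poly_wo2 i j z = gen_poly_wo2 j i z.
Proof. by apply: eq_bigl => k; rewrite andbC. Qed.

Lemma deriv_gen_poly_wo i z :
  (gen_poly_wo i z)^`() = \sum_(j | j != i) (z 0 j)%:P * gen_poly_wo2 i j z.
Proof.
rewrite /gen_poly_wo; transitivity
  ((\prod_(k in [set~ i]%SET) ((z 0 k)%:P * 'X + 1))^`()).
  by congr (_^`()); apply: eq_bigl => k; rewrite !inE.
rewrite deriv_prod_set; apply: eq_big => j; first by rewrite !inE.
move=> _; rewrite derivD derivM derivC derivX mul0r add0r mulr1 derivC addr0.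
by congr (_ * _); apply: eq_bigl => k; rewrite !inE.
Qed.

Lemma gen_polyE i z : gen_poly z = gen_poly_wo i z + (z 0 i)%:P * 'X * gen_poly_wo i z.
Proof. by rewrite /gen_poly (bigD1 i) //= mulrDl mul1r addrC. Qed.

Lemma gen_poly_woE i j z : j != i ->
  gen_poly_wo i z = gen_poly_wo2 i j z + (z 0 j)%:P * 'X * gen_poly_wo2 i j z.
Proof. by move=> ji; rewrite /gen_poly_wo (bigD1 j) //= mulrDl mul1r addrC. Qed.

(** From P = (1 + z_i X) P_i follows P_i = P - X z_i P_i, and the z_i P_i add up to P'. *)
Lemma sum_gen_poly_wo z :
  \sum_i gen_poly_wo i z = N%:R * gen_poly z - 'X * (gen_poly z)^`().
Proof.
rewrite deriv_gen_poly big_distrr /=.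
rewrite (_ : N%:R * gen_poly z = \sum_(i < N) gen_poly z); last first.
  by rewrite sumr_const card_ord mulr_natl.
by rewrite -sumrB; apply: eq_bigr => i _; rewrite (gen_polyE i); ring.
Qed.

(** The argument of [sum_gen_poly_wo] for each P_i, which has N - 1 factors. *)
Lemma sum_gen_poly_wo2 z :
  \sum_i \sum_(j | j != i) gen_poly_wo2 i j z
  = (N%:R - 1) * (\sum_i gen_poly_wo i z) - 'X * (\sum_i gen_poly_wo i z)^`().
Proof.
rewrite raddf_sum !big_distrr /= -sumrB; apply: eq_bigr => i _.
rewrite deriv_gen_poly_wo big_distrr /=.
rewrite (_ : (N%:R - 1) * _ = \sum_(j | j != i) gen_poly_wo i z); last first.
  have -> : N%:R - 1 = (#|predC1 i|)%:R :> {poly R}.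
    have := cardC1 i; rewrite card_ord => ->.
    by case: (N) i => [[]//|m _]; rewrite /= -natr1 addrK.
  by rewrite sumr_const mulr_natl.
by rewrite -sumrB; apply: eq_bigr => j ji; rewrite (@gen_poly_woE i j) //; ring.
Qed.

Lemma sum_pair_swap (V : zmodType) (F : 'I_N -> 'I_N -> V) :
  \sum_i \sum_(j | j != i) F i j = \sum_i \sum_(j | j != i) F j i.
Proof.
rewrite (exchange_big_dep xpredT) //=; apply: eq_bigr => i _.
by apply: eq_bigl => j; rewrite eq_sym.
Qed.

(** The poles cancel in pairs: with P_i = (1 + z_j X) Q and P_j = (1 + z_i X) Q, the difference
    (z_i^2 - 1) P_i - (z_j^2 - 1) P_j equals (z_i - z_j) (z_i + z_j + X (z_i z_j + 1)) Q. *)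
Lemma sum_interaction_gen_poly z :
  (forall i j, i != j -> z 0 i != z 0 j) ->
  \sum_i \sum_(j | j != i)
     (2 * (z 0 i ^+ 2 - 1) / (z 0 i - z 0 j))%:P * ('X * gen_poly_wo i z)
  = \sum_i \sum_(j | j != i)
     'X * ((z 0 i)%:P + (z 0 j)%:P + 'X * ((z 0 i)%:P * (z 0 j)%:P + 1))
     * gen_poly_wo2 i j z.
Proof.
move=> zinj; set S := LHS; set T := RHS.
have two0 : (2 : {poly R}) != 0 by rewrite -polyC_natr polyC_eq0 pnatr_eq0.
(* The sum is doubled and its second copy has i and j exchanged, so the two terms of a pair meet. *)
apply: (mulfI two0); rewrite mulrDl mul1r {2}/S sum_pair_swap -big_split /=.
rewrite /T big_distrr /=; apply: eq_bigr => i _.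
rewrite -big_split big_distrr /=; apply: eq_bigr => j ji.
rewrite (@gen_poly_woE i j) // (@gen_poly_woE j i) 1?eq_sym // (gen_poly_wo2C j i).
have zij : z 0 i - z 0 j != 0 by rewrite subr_eq0 zinj // eq_sym.
set a := z 0 i in zij *; set b := z 0 j in zij *.
have -> : 2 * (b ^+ 2 - 1) / (b - a) = - (2 * (b ^+ 2 - 1)) / (a - b).
  by rewrite -(opprB a b) invrN mulrN mulNr.
set u := (a - b)^-1.
have hu : u%:P * (a%:P - b%:P) = 1 :> {poly R}.
  by rewrite -polyCB -polyCM mulVf.
rewrite !(polyCM, polyCN, polyCD, polyC_exp, polyC1, polyC_natr).
transitivity (u%:P * (a%:P - b%:P) * (2 * ('X *
   (a%:P + b%:P + 'X * (a%:P * b%:P + 1)) * gen_poly_wo2 i j z))).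
  ring.
by rewrite hu mul1r.
Qed.

(** Each of the two linear terms gives X times the derivative of the sum of the P_i, the product z_i
    z_j gives P'', and the constant leaves the double sum itself. *)
Lemma sum_interaction_wo2 z :
  \sum_i \sum_(j | j != i)
     'X * ((z 0 i)%:P + (z 0 j)%:P + 'X * ((z 0 i)%:P * (z 0 j)%:P + 1))
     * gen_poly_wo2 i j z
  = 2 * 'X * (\sum_i gen_poly_wo i z)^`() + 'X ^+ 2 * (gen_poly z)^`()^`()
    + 'X ^+ 2 * \sum_i \sum_(j | j != i) gen_poly_wo2 i j z.
Proof.
transitivity (\sum_i \sum_(j | j != i)
   ('X * ((z 0 i)%:P * gen_poly_wo2 i j z) + 'X * ((z 0 j)%:P * gen_poly_wo2 i j z)
    + 'X ^+ 2 * ((z 0 i)%:P * ((z 0 j)%:P * gen_poly_wo2 i j z))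
    + 'X ^+ 2 * gen_poly_wo2 i j z)).
  by apply: eq_bigr => i _; apply: eq_bigr => j _; ring.
under eq_bigr do rewrite !big_split /=.
rewrite !big_split /=; congr (_ + _ + _); last 2 first.
- rewrite deriv_gen_poly raddf_sum big_distrr /=; apply: eq_bigr => i _.
  by rewrite -!big_distrr /= -deriv_gen_poly_wo derivM derivC mul0r add0r.
- by rewrite big_distrr /=; apply: eq_bigr => i _; rewrite big_distrr.
rewrite (sum_pair_swap (fun i j => 'X * ((z 0 i)%:P * gen_poly_wo2 i j z))).
rewrite -mulrA mulrDl mul1r raddf_sum big_distrr /=; congr (_ + _).
  apply: eq_bigr => i _; rewrite -big_distrr /= deriv_gen_poly_wo.
  by congr (_ * _); apply: eq_bigr => j _; rewrite gen_poly_wo2C.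
by apply: eq_bigr => i _; rewrite -big_distrr /= deriv_gen_poly_wo.
Qed.

(* The off-diagonal coefficients of the linear system for the E_n. *)
Definition coupling (p q : R) (n m : nat) : R :=
  if n == m.+1 then (q - p) * (N%:R - m%:R)
  else if n == m.+2 then (N%:R - m%:R) * (N%:R - m%:R - 1)
  else 0.

Lemma sum_coupling p q n (u : nat -> R) :
  \sum_(m < n) coupling p q n m * u m
  = (if n is m.+1 then coupling p q m.+1 m * u m else 0)
    + (if n is m.+2 then coupling p q m.+2 m * u m else 0).
Proof.
case: n => [|[|n]]; first by rewrite big_ord0 addr0.
  by rewrite big_ord1 addr0.
rewrite !big_ord_recr /= [X in X + _ + _]big1 ?add0r 1?addrC // => i _.
rewrite /coupling.
by rewrite !eqSS !gtn_eqF ?mul0r //; apply: leqW.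
Qed.

Lemma drift_elem_sym z (p q k c : R) (n : nat) :
  (forall i j, i != j -> z 0 i != z 0 j) ->
  2 * k + c = 2 * (p - (N%:R - 1)) ->
  \sum_i (c * z 0 i + (q - p) * (z 0 i + 1) + 2 * k * z 0 i
     + \sum_(j | j != i) 2 * (z 0 i ^+ 2 - 1) / (z 0 i - z 0 j)) * elem_sym_der i n z
  = rate p q n * elem_sym n z + \sum_(m < n) coupling p q n m * elem_sym m z.
Proof.
move=> zinj hk.
set P := gen_poly z.
transitivity (((2 * (p - (N%:R - 1)) + (q - p))%:P * ('X * P^`())
   + (q - p)%:P * ('X * \sum_i gen_poly_wo i z)
   + \sum_i \sum_(j | j != i)
     (2 * (z 0 i ^+ 2 - 1) / (z 0 i - z 0 j))%:P * ('X * gen_poly_wo i z))`_n).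
  rewrite /P deriv_gen_poly !big_distrr /= -!big_split coef_sum /=.
  apply: eq_bigr => i _; rewrite -coef_gen_poly_wo -hk -mulr_suml -rmorph_sum /=.
  rewrite -coefCM; apply: (congr1 (fun r : {poly R} => r`_n)); set s := \sum_(_ | _) _.
  by rewrite !(polyCM, polyCN, polyCD, polyC1, polyC_natr); ring.
rewrite sum_interaction_gen_poly // sum_interaction_wo2 sum_gen_poly_wo2 sum_gen_poly_wo.
rewrite -/P.
(* The first coefficient is p + q. As X P' and X^2 P'' act on degree n by n and n (n - 1), the first
   line and the P'' term below it produce r_n; the rest shifts the degree by one and by two. *)
transitivity (((2 * (p - (N%:R - 1)) + (q - p) + 2 * (N%:R - 1))%:P * ('X * P^`())
   - 'X ^+ 2 * P^`()^`()
   + (q - p)%:P * ('X * (N%:R%:P * P - 'X * P^`()))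
   + 'X^2 * ((N%:R * (N%:R - 1))%:P * P - (2 * (N%:R - 1))%:P * ('X * P^`())
       + 'X ^+ 2 * P^`()^`()))`_n).
  apply: (congr1 (fun r : {poly R} => r`_n)); rewrite -polyC_natr !(derivB, derivM, derivX, derivC) !(polyCM, polyCN, polyCD, polyC1, polyC_natr) /=.
  ring.
rewrite (sum_coupling _ _ _ (fun m => elem_sym m z)) -coef_gen_poly -/P /rate.
case: n => [|[|n]];
  rewrite !(coefD, coefN, coefCM, coefXM, coefXnM, coef_deriv) /= -?coef_gen_poly -/P.
- ring.
- rewrite /coupling /=; ring.
- have -> : (n.+2 - 2)%N = n by rewrite subn2.
  rewrite /coupling !eqSS eqxx (gtn_eqF (ltnSn n)).
  (* In the low degrees, where the coefficient of the shifted polynomial is 0 by default, the factor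
     n, and below n (n - 1), vanishes as well. *)
  have -> : (if n == 0%N then 0 else P`_n.-1.+1 *+ n.-1.+1) = n%:R * P`_n.
    by case: n => [|n]; rewrite ?mul0r // mulr_natl.
  have -> : (if (n < 2)%N then 0 else P`_(n - 2).+2 *+ (n - 2).+2 *+ (n - 2).+1)
      = n%:R * (n%:R - 1) * P`_n.
    case: n => [|[|n]]; rewrite ?mul0r // ?subrr ?mulr0 ?mul0r //.
    have -> : (n.+2 - 2)%N = n by rewrite subn2.
    rewrite ltnNge /= -mulr_natl -(mulr_natl (P`_n.+2)).
    ring.
  rewrite -[P`_n.+2 *+ n.+2 *+ n.+1]mulr_natl -[P`_n.+2 *+ n.+2]mulr_natl.
  rewrite -[P`_n.+1 *+ n.+1]mulr_natl.
  move: (P`_n) (P`_n.+1) (P`_n.+2) => p0 p1 p2.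
  ring.
Qed.

End Algebra.

(** * Hyperbolic functions *)

Section Hyperbolic.
Variable R : realType.
Implicit Types x y a b : R.

Lemma is_derive_cosh x : is_derive x 1 (@cosh R) (sinh x).
Proof.
rewrite /cosh /sinh; apply: is_derive_eq.
by rewrite /GRing.scale /=; field.
Qed.

Lemma is_derive_sinh x : is_derive x 1 (@sinh R) (cosh x).
Proof.
rewrite /cosh /sinh; apply: is_derive_eq.
by rewrite /GRing.scale /=; field.
Qed.

Lemma continuous_cosh : continuous (@cosh R).
Proof.
by move=> x; apply: differentiable_continuous; apply/derivable1_diffP; have [] := is_derive_cosh x.
Qed.

Lemma continuous_sinh : continuous (@sinh R).
Proof.
by move=> x; apply: differentiable_continuous; apply/derivable1_diffP; have [] := is_derive_sinh x.
Qed.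

Lemma coshN x : cosh (- x) = cosh x.
Proof. by rewrite /cosh opprK addrC. Qed.

Lemma cosh2 x : cosh x ^+ 2 - sinh x ^+ 2 = 1.
Proof.
have e0 : expR x != 0 by rewrite gt_eqF // expR_gt0.
by rewrite /cosh /sinh expRN; field.
Qed.

Lemma cosh_ge_norm x : 1 + `|x| <= 2 * cosh x.
Proof.
rewrite /cosh mulrC divfK //.
have := expR_ge1Dx x; have := expR_ge1Dx (- x); have := expR_gt0 x; have := expR_gt0 (- x).
by case: (ger0P x); lra.
Qed.

Lemma cosh_ge1 x : 1 <= cosh x.
Proof.
have e0 := expR_gt0 x.
rewrite /cosh ler_pdivlMr // mul1r expRN -(ler_pM2r e0) [leRHS]mulrDl (mulVf (lt0r_neq0 e0)).
have := sqr_ge0 (expR x - 1); nra.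
Qed.

Lemma norm_sinh_le x : `|sinh x| <= cosh x.
Proof.
have := expR_gt0 x; have := expR_gt0 (- x).
by rewrite ler_norml /cosh /sinh => ? ?; apply/andP; split; lra.
Qed.

Lemma sinh_neq0 x : x != 0 -> sinh x != 0.
Proof.
apply: contraNN; rewrite /sinh mulf_eq0 invr_eq0 pnatr_eq0 orbF subr_eq0.
by move=> /eqP/expR_inj xN; apply/eqP; lra.
Qed.

Lemma coshB a b : cosh a - cosh b = 2 * (sinh ((a - b) / 2) * sinh ((a + b) / 2)).
Proof.
have := expR_gt0 ((a + b) / 2); have := expR_gt0 ((a - b) / 2).
rewrite /cosh /sinh !expRN.
have -> : expR a = expR ((a + b) / 2) * expR ((a - b) / 2).
  by rewrite -expRD; congr expR; field.
have -> : expR b = expR ((a + b) / 2) / expR ((a - b) / 2).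
  by rewrite -expRB; congr expR; field.
move=> /lt0r_neq0 u0 /lt0r_neq0 v0.
by field; rewrite u0 v0.
Qed.

Lemma cosh_inj_pos a b : 0 < a -> 0 < b -> a != b -> cosh a != cosh b.
Proof.
move=> a0 b0 ab; rewrite -subr_eq0 coshB mulf_neq0 // mulf_neq0 // sinh_neq0 //.
  by rewrite mulf_neq0 // subr_eq0.
by rewrite gt_eqF // divr_gt0 // addr_gt0.
Qed.

Lemma coth_mul_sinh x : x != 0 -> coth x * sinh x = cosh x.
Proof. by move=> x0; rewrite /coth divfK // sinh_neq0. Qed.

(** Both sides are 2 cosh(x/2)^2; the computation is done in u = e^{x/2}. *)
Lemma coth_half_mul_sinh x : x != 0 -> coth (x / 2) * sinh x = cosh x + 1.
Proof.
move=> x0; have := @sinh_neq0 (x / 2); rewrite mulf_neq0 // => /(_ isT).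
have := expR_gt0 (x / 2); rewrite /coth /cosh /sinh !expRN.
have -> : expR x = expR (x / 2) ^+ 2.
  by rewrite -expRM_natl; congr expR; field.
set u := expR _ => /lt0r_neq0 u0 /= h.
have h1 : u ^+ 2 - 1 != 0.
  apply: contraNN h => /eqP h2; have -> : u - u^-1 = (u ^+ 2 - 1) / u by field.
  by rewrite h2 !mul0r.
by field; rewrite u0.
Qed.

(** By the addition formula the two coths add up to sinh a over the product of the half-angle sinhs,
    and that product is (cosh a - cosh b) / 2 by [coshB]. *)
Lemma coth_pair_mul_sinh a b : a != b -> a + b != 0 ->
  (coth ((a - b) / 2) + coth ((a + b) / 2)) * sinh a
  = 2 * (cosh a ^+ 2 - 1) / (cosh a - cosh b).
Proof.
move=> ab apb; rewrite coshB.
have s1 : sinh ((a - b) / 2) != 0 by rewrite sinh_neq0 // mulf_neq0 // subr_eq0.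
have s2 : sinh ((a + b) / 2) != 0 by rewrite sinh_neq0 // mulf_neq0.
have -> : cosh a ^+ 2 - 1 = sinh a ^+ 2 by rewrite -(cosh2 a); ring.
have -> : sinh a = cosh ((a - b) / 2) * sinh ((a + b) / 2)
                 + cosh ((a + b) / 2) * sinh ((a - b) / 2).
  have := expR_gt0 ((a + b) / 2); have := expR_gt0 ((a - b) / 2).
  rewrite /cosh /sinh !expRN.
  have -> : expR a = expR ((a + b) / 2) * expR ((a - b) / 2).
    by rewrite -expRD; congr expR; field.
  move=> /lt0r_neq0 u0 /lt0r_neq0 v0.
  by field; rewrite u0 v0.
by rewrite /coth; field; rewrite s1 s2.
Qed.

End Hyperbolic.

(** * Continuously differentiable functions on row vectors *)

Section C1.
Variables (R : realType) (N : nat).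
Implicit Types (f g : 'rV[R]_N -> R) (df dg : 'I_N -> 'rV[R]_N -> R).

(** The partial derivatives are carried along explicitly, so that they are computed by rules; two
    applications yield [is_C2]. Total differentiability is included for the sake of the chain
    rule. *)
Definition C1 f df : Prop :=
  [/\ forall x, differentiable f x,
      forall i x, 'D_(delta_mx 0 i) f x = df i x &
      forall i, continuous (df i)].

Lemma C1_continuous f df : C1 f df -> continuous f.
Proof. by move=> [h _ _] x; exact: differentiable_continuous. Qed.

Lemma C1_ext f g df dg : C1 f df -> f =1 g -> (forall i, df i =1 dg i) -> C1 g dg.
Proof.
move=> Cf /funext <- dfg; suff <- : df = dg by [].
by apply/funext => i; apply/funext => x; exact: dfg.
Qed.

Lemma C1_cst c : C1 (fun=> c) (fun _ _ => 0).
Proof.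
split => [x|i x|i]; first exact: differentiable_cst.
  exact: derive_cst.
by move=> x; exact: cst_continuous.
Qed.

Lemma C1D f g df dg : C1 f df -> C1 g dg ->
  C1 (fun x => f x + g x) (fun i x => df i x + dg i x).
Proof.
move=> [f1 f2 f3] [g1 g2 g3]; split => [x|i x|i x].
- exact: differentiableD.
- by rewrite deriveD ?f2 ?g2 //; exact: diff_derivable.
- exact: cvgD (f3 i x) (g3 i x).
Qed.

Lemma C1M f g df dg : C1 f df -> C1 g dg ->
  C1 (fun x => f x * g x) (fun i x => df i x * g x + f x * dg i x).
Proof.
move=> Cf Cg; have [f1 f2 f3] := Cf; have [g1 g2 g3] := Cg; split => [x|i x|i x].
- exact: differentiableM.
- rewrite deriveM ?f2 ?g2; [|exact: diff_derivable..].
  by rewrite /GRing.scale /= addrC mulrC.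
- have fx := @C1_continuous f df Cf x; have gx := @C1_continuous g dg Cg x.
  exact: cvgD (cvgM (f3 i x) gx) (cvgM fx (g3 i x)).
Qed.

Lemma C1_coord (k : 'I_N) : C1 (fun x => x 0 k) (fun i _ => (i == k)%:R).
Proof.
split => [x|i x|i]; first exact: differentiable_coord.
  have := derive_mx (@derivable_id _ _ x (delta_mx 0 i : 'rV[R]_N)).
  by rewrite derive_id => /matrixP/(_ 0 k); rewrite !mxE /= => <-; rewrite eq_sym.
by move=> y; exact: cst_continuous.
Qed.

Lemma C1_comp (h h' : R -> R) f df :
  (forall y : R, is_derive y 1 h (h' y)) -> continuous h' -> C1 f df ->
  C1 (fun x => h (f x)) (fun i x => h' (f x) * df i x).
Proof.
move=> hd h'c Cf; have [f1 f2 f3] := Cf.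
have dh y : differentiable h y by apply/derivable1_diffP; have [] := hd y.
split => [x|i x|i x]; first exact: (@differentiable_comp _ _ _ _ f h).
- rewrite deriveE; last exact: (@differentiable_comp _ _ _ _ f h).
  rewrite (@diff_comp _ _ _ _ f h) //= diff1E //= derive1E (@derive_val _ _ _ _ _ _ _ (hd _)).
  by rewrite -f2 deriveE // /GRing.scale /= mulrC.
- have fx := @C1_continuous f df Cf x.
  exact: cvgM (continuous_comp fx (h'c _)) (f3 i x).
Qed.

Lemma C1_sum (I : Type) (r : seq I) (Q : pred I) (F : I -> 'rV[R]_N -> R)
    (dF : I -> 'I_N -> 'rV[R]_N -> R) :
  (forall j, Q j -> C1 (F j) (dF j)) ->
  C1 (fun x => \sum_(j <- r | Q j) F j x) (fun i x => \sum_(j <- r | Q j) dF j i x).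
Proof.
move=> CF; elim: r => [|j r IH].
  by apply: (C1_ext (C1_cst 0)) => [x|i x]; rewrite big_nil.
case Qj: (Q j); last by apply: (C1_ext IH) => [x|i x]; rewrite big_cons Qj.
by apply: (C1_ext (C1D (CF j Qj) IH)) => [x|i x]; rewrite big_cons Qj.
Qed.

Lemma C1_prod (I : finType) (A : {set I}) (F : I -> 'rV[R]_N -> R)
    (dF : I -> 'I_N -> 'rV[R]_N -> R) :
  (forall j, C1 (F j) (dF j)) ->
  C1 (fun x => \prod_(j in A) F j x)
     (fun i x => \sum_(j in A) dF j i x * \prod_(k in A | k != j) F k x).
Proof.
move=> CF; have [m] := ubnP #|A|; elim: m A => // m IH A.
have [->|[a aA]] := set_0Vmem A.
  by move=> _; apply: (C1_ext (C1_cst 1)) => [x|i x]; rewrite big_set0.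
rewrite (cardsD1 a) aA ltnS => /IH CA.
apply: (C1_ext (C1M (CF a) CA)) => [x|i x]; first by rewrite (big_setD1 a aA).
rewrite [RHS](big_setD1 a aA) /=; congr (_ * _ + _).
  by apply: eq_bigl => k; rewrite !inE andbC.
rewrite big_distrr /=; apply: eq_bigr => j; rewrite !inE => /andP[ja jA].
rewrite [X in _ = _ * X](bigD1 a) /= ?aA 1?eq_sym // mulrCA; congr (_ * (_ * _)).
by apply: eq_bigl => k; rewrite !inE; case: (k == a); rewrite ?andbF ?andbT.
Qed.

End C1.

(** * Concave truncations of the identity *)

Section PosPart.
Variable R : realType.

Definition pos_part (y : R) : R := Num.max 0 y.

Lemma pos_part_ge0 y : 0 <= pos_part y.
Proof. by rewrite /pos_part le_max lexx. Qed.

Lemma pos_partE y : pos_part y = (y + `|y|) / 2.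
Proof. by rewrite /pos_part /Num.max; case: ltP => y0; [rewrite gtr0_norm|rewrite ler0_norm]; lra. Qed.

Lemma continuous_pos_part : continuous pos_part.
Proof.
move=> y; rewrite (_ : pos_part = fun y => (y + `|y|) / 2); last first.
  by apply/funext => ?; rewrite pos_partE.
by apply: cvgM; [apply: cvgD; [exact: cvg_id|exact: norm_continuous]|exact: cvg_cst].
Qed.

(** The error of the first order expansion is at most h^2, whatever the signs of y and y + h; this
    also covers the kink at 0. *)
Lemma is_derive_pos_part_sqr (y : R) :
  is_derive y 1 (fun u : R => pos_part u ^+ 2) (2 * pos_part y).
Proof.
have key : (fun h : R => h^-1 *: (pos_part (h *: (1 : R) + y) ^+ 2 - pos_part y ^+ 2))
    @ 0^' --> 2 * pos_part y.
  apply/cvgrPdist_le => /= e e0; near=> h.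
  have h0 : h != 0 by near: h; exact: nbhs_dnbhs_neq.
  have he : `|h| <= e by near: h; apply: dnbhs0_le.
  apply: le_trans he; rewrite /GRing.scale /= mulr1.
  (* Multiplying by |h| turns the bound on the difference quotient into this quadratic estimate. *)
  rewrite -(ler_pM2l (_ : 0 < `|h|)) ?normr_gt0 // -normrM mulrBr (mulrA h h^-1) divff // mul1r.
  rewrite -expr2 real_normK ?num_real //.
  rewrite ler_norml /pos_part /Num.max; case: (ltP 0 (h + y)) => hy; case: (ltP 0 y) => y0.
  - by rewrite -subr_ge0 -[X in _ && X]subr_ge0; apply/andP; split; nra.
  - have h1 : h + y <= h by lra.
    have : (h + y) ^+ 2 <= h ^+ 2 by rewrite ler_sqr ?nnegrE; lra.
    by move=> ?; apply/andP; split; nra.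
  - have := sqr_ge0 (h + y) ; have : y * (y + 2 * h) <= 0 by apply: mulr_ge0_le0; lra.
    by move=> ? ?; have := sqr_ge0 h; move=> ?; apply/andP; split; nra.
  - by have := sqr_ge0 h => ?; apply/andP; split; nra.
by split; [apply/cvg_ex; exists (2 * pos_part y)|exact: cvg_lim key].
Unshelve. all: by end_near. Qed.

(** No second limit is computed: the cube is u times the square of the positive part, so the product
    rule applies. *)
Lemma is_derive_pos_part_cube (y : R) :
  is_derive y 1 (fun u : R => pos_part u ^+ 3) (3 * pos_part y ^+ 2).
Proof.
have mul_pos (u : R) n : u * pos_part u ^+ n.+1 = pos_part u ^+ n.+2.
  rewrite [RHS]exprS; rewrite /pos_part /Num.max; case: ltP => // _.
  by rewrite !exprS !mul0r mulr0.
rewrite (_ : (fun u => _) = (fun u : R => u * pos_part u ^+ 2)); last first.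
  by apply/funext => u; rewrite mul_pos.
have d2 := is_derive_pos_part_sqr y.
have := @is_deriveM R R id (fun u : R => pos_part u ^+ 2) y 1 1 _ (is_derive_id _ _) d2.
move=> /(@is_derive_eq _ _ _ _ _ _ _ _); apply.
rewrite /GRing.scale /= mulr1 mulrCA -[pos_part y]expr1 mul_pos expr1; ring.
Qed.

(* A primitive of (1 - v / m)_+ ^ 2, hence concave; constant from m on. *)
Definition phi (m v : R) : R := m / 3 - m / 3 * pos_part (1 - v / m) ^+ 3.
Definition dphi (m v : R) : R := pos_part (1 - v / m) ^+ 2.
Definition ddphi (m v : R) : R := - (2 / m) * pos_part (1 - v / m).

Lemma is_derive_affine (m v : R) : is_derive v 1 (fun u : R => 1 - u / m) (- m^-1).
Proof.
apply: is_derive_eq; rewrite /GRing.scale /=.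
ring.
Qed.

Lemma is_derive_comp_affine (h h' : R -> R) (m v : R) :
  (forall y : R, is_derive y 1 h (h' y)) ->
  is_derive v 1 (fun u : R => h (1 - u / m)) (- m^-1 * h' (1 - v / m)).
Proof.
move=> hd; have := @is_derive1_comp R h (fun u : R => 1 - u / m) v _ _ (hd _) (is_derive_affine m v).
by rewrite mulrC.
Qed.

Lemma is_derive_phi (m v : R) : m != 0 -> is_derive v 1 (phi m) (dphi m v).
Proof.
move=> m0; have d3 := is_derive_comp_affine m v is_derive_pos_part_cube.
rewrite /phi; apply: is_derive_eq.
by rewrite /GRing.scale /= /dphi; field.
Qed.

Lemma is_derive_dphi (m v : R) : is_derive v 1 (dphi m) (ddphi m v).
Proof.
have := is_derive_comp_affine m v is_derive_pos_part_sqr.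
by rewrite /ddphi /dphi mulrA mulNr [m^-1 * 2]mulrC.
Qed.

Lemma continuous_dphi m : continuous (dphi m).
Proof.
by move=> v; apply: differentiable_continuous; apply/derivable1_diffP; have [] := is_derive_dphi m v.
Qed.

Lemma continuous_ddphi m : continuous (ddphi m).
Proof.
move=> v; have cu : {for v, continuous (fun u : R => 1 - u / m)}.
  apply: differentiable_continuous; apply/derivable1_diffP.
  by have [] := is_derive_affine m v.
exact: cvgM (cvg_cst _) (continuous_comp cu (@continuous_pos_part _)).
Qed.

Lemma dphi_ge0 m v : 0 <= dphi m v.
Proof. exact: sqr_ge0. Qed.

Lemma dphi_le1 m v : 0 < m -> 0 <= v -> dphi m v <= 1.
Proof.
move=> m0 v0; rewrite /dphi expr_le1 ?pos_part_ge0 //.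
by rewrite /pos_part ge_max ler01 lerBlDr lerDl divr_ge0 // ltW.
Qed.

Lemma phi_eq_cst m v : 0 < m -> m <= v -> phi m v = m / 3.
Proof.
move=> m0 mv; rewrite /phi; have -> : pos_part (1 - v / m) = 0.
  by rewrite /pos_part max_l // subr_le0 ler_pdivlMr // mul1r.
by rewrite expr0n /= mulr0 subr0.
Qed.
Lemma dphi_eq0 m v : 0 < m -> m <= v -> dphi m v = 0.
Proof.
move=> m0 mv; rewrite /dphi /pos_part max_l ?expr0n //.
by rewrite subr_le0 ler_pdivlMr // mul1r.
Qed.

Lemma ddphi_eq0 m v : 0 < m -> m <= v -> ddphi m v = 0.
Proof.
move=> m0 mv; rewrite /ddphi /pos_part max_l ?mulr0 //.
by rewrite subr_le0 ler_pdivlMr // mul1r.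
Qed.

Lemma ddphi_le0 m v : 0 < m -> ddphi m v <= 0.
Proof.
by move=> m0; rewrite /ddphi mulNr oppr_le0 mulr_ge0 ?pos_part_ge0 // divr_ge0 // ltW.
Qed.

(** With r = v/m < 1 the left side is 2 r (1 - r). Against a squared gradient of order U^2 this
    absorbs one power of U, uniformly in m. *)
Lemma norm_ddphi_le m v : 0 < m -> 0 <= v -> `|ddphi m v| * v <= 2.
Proof.
move=> m0 v0; have [mv|vm] := leP m v; first by rewrite ddphi_eq0 // normr0 mul0r.
rewrite ler0_norm ?ddphi_le0 // /ddphi /pos_part max_r; last first.
  by rewrite subr_ge0 ler_pdivrMr // mul1r ltW.
have -> : - (- (2 / m) * (1 - v / m)) * v = 2 * ((v / m) * (1 - v / m)).
  by field; rewrite gt_eqF.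
have : v / m <= 1 by rewrite ler_pdivrMr // mul1r ltW.
have : 0 <= v / m by rewrite divr_ge0 // ltW.
set r := v / m; nra.
Qed.

Lemma norm_ddphi_le_inv m v : 0 < m -> 0 <= v -> `|ddphi m v| <= 2 / m.
Proof.
move=> m0 v0; rewrite ler0_norm ?ddphi_le0 // /ddphi mulNr opprK mulrC.
rewrite ler_piMl ?divr_ge0 ?(ltW m0) // /pos_part ge_max ler01 lerBlDr lerDl.
by rewrite divr_ge0 // ltW.
Qed.

(** The tangent inequality at v of a concave function vanishing at 0. It turns L U <= C U into the
    same inequality for phi_m(U). *)
Lemma dphi_mul_le m v : 0 < m -> 0 <= v -> dphi m v * v <= phi m v.
Proof.
move=> m0 v0; have [mv|vm] := leP m v.
  by rewrite dphi_eq0 // mul0r phi_eq_cst // divr_ge0 // ltW.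
rewrite /phi /dphi /pos_part max_r; last first.
  by rewrite subr_ge0 ler_pdivrMr // mul1r ltW.
have -> : v = m * (v / m) by field; rewrite gt_eqF.
rewrite [m * _ / m]mulrAC divff ?gt_eqF // mul1r.
have : v / m <= 1 by rewrite ler_pdivrMr // mul1r ltW.
have : 0 <= v / m by rewrite divr_ge0 // ltW.
set r := v / m => r0 r1; rewrite -subr_ge0.
have -> : m / 3 - m / 3 * (1 - r) ^+ 3 - (1 - r) ^+ 2 * (m * r)
    = m * (r ^+ 2 * (1 - 2 / 3 * r)) by field.
apply: mulr_ge0; first exact: ltW.
by apply: mulr_ge0; [exact: sqr_ge0|lra].
Qed.

Lemma phi_ge0 m v : 0 < m -> 0 <= v -> 0 <= phi m v.
Proof.
by move=> m0 v0; apply: le_trans (dphi_mul_le m0 v0); rewrite mulr_ge0 ?dphi_ge0.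
Qed.

Lemma phi_le m v : 0 < m -> 0 <= v -> phi m v <= v.
Proof.
move=> m0 v0; rewrite /phi.
(* What remains is Bernoulli's inequality: the cube of (1 - r)_+ is at least 1 - 3r. *)
suff : m / 3 * (1 - v / m * 3) <= m / 3 * pos_part (1 - v / m) ^+ 3.
  have -> : m / 3 * (1 - v / m * 3) = m / 3 - v by field; rewrite gt_eqF.
  by lra.
apply: ler_wpM2l; first by rewrite divr_ge0 // ltW.
have : 0 <= v / m by rewrite divr_ge0 // ltW.
rewrite /pos_part; set r := v / m => r0; rewrite /Num.max; case: ltP => r1.
  have -> : (1 - r) ^+ 3 = (1 - r * 3) + r ^+ 2 * (3 - r) by ring.
  by rewrite lerDl mulr_ge0 ?sqr_ge0 //; lra.
by rewrite expr0n /=; lra.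
Qed.

Lemma phi_le_third m v : 0 < m -> phi m v <= m / 3.
Proof.
by move=> m0; rewrite /phi gerBl mulr_ge0 ?divr_ge0 ?exprn_ge0 ?pos_part_ge0 ?ltW.
Qed.

(** Together with [phi_le] this bounds the distance from phi_m(v) to v by v^2 / m. *)
Lemma phi_ge m v : 0 < m -> 0 <= v -> v - v ^+ 2 / m <= phi m v.
Proof.
move=> m0 v0; have [mv|vm] := leP m v.
  apply: le_trans (phi_ge0 m0 v0); rewrite subr_le0 ler_pdivlMr // expr2.
  by rewrite ler_wpM2l.
apply: le_trans (_ : phi m v <= _) => //.
rewrite /phi /pos_part max_r; last first.
  by rewrite subr_ge0 ler_pdivrMr // mul1r ltW.
rewrite -subr_ge0.
have -> : m / 3 - m / 3 * (1 - v / m) ^+ 3 - (v - v ^+ 2 / m) = v ^+ 3 / m ^+ 2 / 3.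
  by field; rewrite gt_eqF.
by rewrite !divr_ge0 // exprn_ge0 // ltW.
Qed.

Lemma dphi_ge m v : 0 < m -> 1 - 2 * v / m <= dphi m v.
Proof.
move=> m0; have -> : 2 * v / m = 2 * (v / m) by rewrite mulrA.
rewrite /dphi /pos_part /Num.max; set r := v / m; case: ltP => r1.
  have -> : (1 - r) ^+ 2 = 1 - 2 * r + r ^+ 2 by ring.
  by rewrite lerDl sqr_ge0.
by rewrite expr0n /=; lra.
Qed.

End PosPart.

(** * Symmetric functions of the hyperbolic cosines *)

Section CoshSymmetric.
Variables (R : realType) (N : nat).
Implicit Types (x : 'rV[R]_N) (c : nat -> R).

Definition cosh_elem n x : R := elem_sym n (cosh_vec x).

Definition cosh_elem_der i n x : R := elem_sym_der i n (cosh_vec x).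

Lemma C1_cosh_coord (k : 'I_N) :
  C1 (fun x => cosh (x 0 k)) (fun i x => sinh (x 0 k) * (i == k)%:R).
Proof.
exact: C1_comp (@is_derive_cosh R) (@continuous_sinh R) (@C1_coord R N k).
Qed.

Lemma C1_sinh_coord (k : 'I_N) :
  C1 (fun x => sinh (x 0 k)) (fun i x => cosh (x 0 k) * (i == k)%:R).
Proof.
exact: C1_comp (@is_derive_sinh R) (@continuous_cosh R) (@C1_coord R N k).
Qed.

(** The factor [sinh (x 0 i)] is kept in front because it cancels the poles of the drift. *)
Lemma C1_cosh_prod (h : {set 'I_N}) :
  C1 (fun x => \prod_(k in h) cosh_vec x 0 k)
     (fun i x => sinh (x 0 i) *
        (if i \in h then \prod_(k in h | k != i) cosh_vec x 0 k else 0)).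
Proof.
apply: (C1_ext (C1_prod h (fun j => C1_cosh_coord j))) => [x|i x].
  by apply: eq_bigr => k _; rewrite mxE.
have [ih|ih] := boolP (i \in h); last first.
  rewrite mulr0 big1 // => j jh; case: eqP => [ij|_]; last by rewrite mulr0 mul0r.
  by move: jh ih; rewrite ij => ->.
rewrite (bigD1 i) //= eqxx mulr1 [X in _ + X]big1 ?addr0; last first.
  by move=> j /andP[_ /negbTE ji] /=; rewrite (eq_sym i) ji mulr0 mul0r.
by congr (_ * _); apply: eq_bigr => k _; rewrite mxE.
Qed.

Lemma C1_cosh_elem n :
  C1 (cosh_elem n) (fun i x => sinh (x 0 i) * cosh_elem_der i n x).
Proof.
apply: (C1_ext (C1_sum (index_enum _) (fun h : {set 'I_N} => fun _ : #|h| == n => C1_cosh_prod h))) => [//|i x].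
rewrite -big_distrr /= /cosh_elem_der /elem_sym_der; congr (_ * _).
by rewrite [RHS]big_mkcondr.
Qed.

(** The cofactor of sinh x_i does not involve x_i, as E_n is affine in cosh x_i. Its other partial
    derivatives are left unnamed. *)
Lemma C1_cosh_elem_der i n :
  exists2 dd, C1 (cosh_elem_der i n) dd & forall x, dd i x = 0.
Proof.
have C (h : {set 'I_N}) (_ : (#|h| == n) && (i \in h)) := C1_cosh_prod (h :\ i)%SET.
have CS := C1_sum (index_enum _) C.
eexists.
  apply: (C1_ext CS) => [x|j x]; last by reflexivity.
  by apply: eq_bigr => h _; apply: eq_bigl => k; rewrite !inE andbC.
by move=> x /=; rewrite big1 // => h _; rewrite !inE eqxx /= mulr0.
Qed.

(** The function U of the overview; its i-th partial derivative is sinh x_i times [comb_der c i]. *)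
Definition comb c x : R := \sum_(n < N.+1) c n * cosh_elem n x.
Definition comb_der c i x : R := \sum_(n < N.+1) c n * cosh_elem_der i n x.

Lemma C1_scale a f df : @C1 R N f df -> C1 (fun x => a * f x) (fun i x => a * df i x).
Proof.
move=> Cf; apply: (C1_ext (C1M (C1_cst N a) Cf)) => // i x.
by rewrite mul0r add0r.
Qed.

Lemma C1_comb c : C1 (comb c) (fun i x => sinh (x 0 i) * comb_der c i x).
Proof.
have C (n : 'I_N.+1) (_ : true) := C1_scale (c n) (C1_cosh_elem n).
apply: (C1_ext (C1_sum (index_enum _) C)) => [//|i x].
by rewrite /comb_der big_distrr /=; apply: eq_bigr => n _; rewrite mulrCA.
Qed.

Lemma C1_comb_der c i : exists2 dd, C1 (comb_der c i) dd & forall x, dd i x = 0.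
Proof.
have /boolp.choice[dd hdd] : forall n : 'I_N.+1, exists dd,
    C1 (cosh_elem_der i n) dd /\ forall x, dd i x = 0.
  by move=> n; have [dd ? ?] := C1_cosh_elem_der i n; exists dd.
have C (n : 'I_N.+1) (_ : true) := C1_scale (c n) (proj1 (hdd n)).
eexists; first exact: (C1_sum (index_enum _) C).
by move=> x /=; rewrite big1 // => n _; rewrite (proj2 (hdd n)) mulr0.
Qed.

Lemma cosh_elem_invariant n : hyperoctahedral_invariant (cosh_elem n).
Proof.
move=> s eps x; rewrite /cosh_elem -!coef_gen_poly; apply: (congr1 (fun r : {poly R} => r`_n)).
rewrite /gen_poly [RHS](reindex_inj (@perm.perm_inj _ s)) /=; apply: eq_bigr => i _.
rewrite !mxE; case: (eps i); first by rewrite expr1 mulN1r coshN.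
by rewrite expr0 mul1r.
Qed.

Lemma cosh_elem_ge0 n x : 0 <= cosh_elem n x.
Proof.
apply: sumr_ge0 => h _; apply: prodr_ge0 => i _; rewrite mxE.
exact: le_trans ler01 (cosh_ge1 _).
Qed.

Lemma cosh_elem_der_ge0 i n x : 0 <= cosh_elem_der i n x.
Proof.
apply: sumr_ge0 => h _; apply: prodr_ge0 => j _; rewrite mxE.
exact: le_trans ler01 (cosh_ge1 _).
Qed.

(** The left side collects the monomials of E_n that contain cosh x_i; the others are
    nonnegative. *)
Lemma cosh_mul_elem_der_le i n x : cosh (x 0 i) * cosh_elem_der i n x <= cosh_elem n x.
Proof.
rewrite /cosh_elem_der /elem_sym_der big_distrr /= [leLHS]big_mkcondr /=.
apply: ler_sum => h _; case: ifP => ih.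
  by rewrite [leRHS](bigD1 i) //= mxE.
by apply: prodr_ge0 => j _; rewrite mxE; exact: le_trans ler01 (cosh_ge1 _).
Qed.

Lemma cosh_coord_le i x : cosh (x 0 i) <= cosh_elem 1 x.
Proof.
apply: le_trans (cosh_mul_elem_der_le i 1 x); rewrite ler_peMr //.
  exact: le_trans ler01 (cosh_ge1 _).
(* The singleton {i} contributes an empty product, hence 1. *)
rewrite /cosh_elem_der /elem_sym_der (bigD1 [set i]%SET) /=; last first.
  by rewrite cards1 eqxx inE eqxx.
rewrite big1 ?lerDl; last by move=> k /andP[]; rewrite inE => /eqP ->; rewrite eqxx.
apply: sumr_ge0 => h _; apply: prodr_ge0 => j _; rewrite mxE.
exact: le_trans ler01 (cosh_ge1 _).
Qed.

Lemma comb_ge0 c x : (forall n, 0 <= c n) -> 0 <= comb c x.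
Proof. by move=> c0; apply: sumr_ge0 => n _; rewrite mulr_ge0 ?cosh_elem_ge0. Qed.

Lemma norm_comb_der_le c i x : (forall n, 0 <= c n) ->
  `|sinh (x 0 i) * comb_der c i x| <= comb c x.
Proof.
move=> c0; have W0 : 0 <= comb_der c i x.
  by apply: sumr_ge0 => n _; rewrite mulr_ge0 ?cosh_elem_der_ge0.
rewrite normrM (ger0_norm W0).
apply: le_trans (ler_wpM2r W0 (norm_sinh_le _)) _.
rewrite /comb_der big_distrr /=; apply: ler_sum => n _.
by rewrite mulrCA; apply: ler_wpM2l => //; exact: cosh_mul_elem_der_le.
Qed.

Lemma norm_coord_le c i x : (forall n, 0 <= c n) ->
  c 1%N * `|x 0 i| <= 2 * comb c x.
Proof.
move=> c0; have N0 : (0 < N)%N by apply: leq_trans (ltn_ord i).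
have le1 : c 1%N * cosh_elem 1 x <= comb c x.
  rewrite /comb (bigD1 (inord 1)) //= inordK ?ltnS // lerDl.
  by apply: sumr_ge0 => n _; rewrite mulr_ge0 ?cosh_elem_ge0.
have := cosh_ge_norm (x 0 i); have := cosh_coord_le i x => h1 h2.
apply: (@le_trans _ _ (2 * (c 1%N * cosh_elem 1 x))); last by rewrite ler_pM2l.
by rewrite mulrCA; apply: ler_wpM2l => //; lra.
Qed.

(** The term c_1 E_1 bounds every coordinate, since 1 + |x_i| <= 2 cosh x_i. This makes the
    truncation of U constant outside a compact set. *)
Lemma compact_comb_sublevel c M : (forall n, 0 <= c n) -> 0 < c 1%N ->
  compact (closure [set x | comb c x < M]).
Proof.
move=> c0 c1; set B := [set x : 'rV[R]_N | `|x| <= 2 * `|M| / c 1%N].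
have sub : [set x | comb c x < M] `<=` B.
  move=> x /= xM; rewrite /B /=.
  rewrite [leLHS]/Num.Def.normr /= mx_normrE; apply: bigmax_le => [|[k i] _].
    by rewrite divr_ge0 // mulr_ge0.
  rewrite /= (ord1 k) ler_pdivlMr // mulrC.
  apply: le_trans (norm_coord_le i x c0) _; rewrite ler_pM2l //.
  exact: le_trans (ltW xM) (ler_norm _).
have closedB : closed B.
  apply: (@closed_comp _ _ (fun x : 'rV[R]_N => `|x|) [set r | r <= 2 * `|M| / c 1%N]).
    by move=> x _; exact: norm_continuous.
  exact: closed_le.
apply: bounded_closed_compact; last exact: closed_closure.
exists (2 * `|M| / c 1%N); split; first exact: num_real.
move=> r Mr x /(closure_subset sub); rewrite -(iffLR (closure_id _) closedB) => xB.
exact: le_trans xB (ltW Mr).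
Qed.

(** Lowering one coordinate by a small amount stays in the chamber, so every weak inequality
    defining it is strict at an interior point. *)
Lemma chamber_interior x : chamberB° x ->
  (forall i, 0 < x 0 i) /\ (forall i j, i != j -> x 0 i != x 0 j).
Proof.
move=> /nbhs_ballP[e /= e0 sub].
have he : 0 < e / 2 by rewrite divr_gt0.
have key (i : 'I_N) : chamberB (x - (e / 2) *: delta_mx 0 i).
  apply: sub; split => // k j; rewrite /ball /= !mxE opprB addrCA subrr addr0.
  rewrite normrM gtr0_norm //; apply: (@le_lt_trans _ _ (e / 2)).
    by rewrite ler_piMr ?(ltW he) //; case: (_ && _); rewrite ?normr0 ?normr1.
  by rewrite ltr_pdivrMr // ltr_pMr // ltr1n.
split => [i|].
  have [_ /(_ i)] := key i; rewrite !mxE !eqxx mulr1 subr_ge0.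
  exact: lt_le_trans.
have lt_coord (i j : 'I_N) : (i < j)%N -> x 0 j < x 0 i.
  move=> ij; have [/(_ i j (ltnW ij)) + _] := key i.
  rewrite !mxE !eqxx [j == i]gtn_eqF // mulr0 subr0 mulr1 => h.
  by apply: le_lt_trans h _; rewrite ltrBlDr ltrDl.
move=> i j; rewrite neq_ltn => /orP[] /lt_coord; first by move/gt_eqF => ->.
by move/lt_eqF => ->.
Qed.

End CoshSymmetric.

(** * Test functions in the domain of the generator *)

Section Generator.
Variables (R : realType) (N : nat) (p q : R).
Implicit Types (x : 'rV[R]_N) (c : nat -> R).

(* The generator applied to [comb c], see [drift_comb]. *)
Definition comb_gen c x : R :=
  \sum_(n < N.+1) c n * (rate p q n * cosh_elem n x
     + \sum_(m < n) coupling N p q n m * cosh_elem m x).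

Lemma drift_mul_sinh k x i :
  (forall j, 0 < x 0 j) -> (forall j l, j != l -> x 0 j != x 0 l) ->
  drift p q k x i * sinh (x 0 i)
  = (q - p) * (cosh_vec x 0 i + 1) + 2 * k * cosh_vec x 0 i
    + \sum_(j | j != i) 2 * (cosh_vec x 0 i ^+ 2 - 1) / (cosh_vec x 0 i - cosh_vec x 0 j).
Proof.
move=> xpos xinj; have xi0 : x 0 i != 0 by rewrite gt_eqF.
rewrite /drift 2!mulrDl -mulrA coth_half_mul_sinh // -[2 * k * _ * _]mulrA coth_mul_sinh //.
rewrite !mxE; congr (_ + _); rewrite mulr_suml; apply: eq_bigr => j ji.
rewrite coth_pair_mul_sinh ?mxE //; first by rewrite xinj // eq_sym.
by rewrite gt_eqF // addr_gt0.
Qed.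

Lemma drift_cosh_elem n k a x : chamberB° x -> 2 * k + a = 2 * (p - (N%:R - 1)) ->
  \sum_i (a * cosh (x 0 i) + drift p q k x i * sinh (x 0 i)) * cosh_elem_der i n x
  = rate p q n * cosh_elem n x + \sum_(m < n) coupling N p q n m * cosh_elem m x.
Proof.
move=> /chamber_interior[xpos xinj] hk.
rewrite -(@drift_elem_sym _ _ _ _ _ k a) //; last first.
  by move=> i j ij; rewrite !mxE; apply: cosh_inj_pos => //; exact: xinj.
by apply: eq_bigr => i _; rewrite drift_mul_sinh // mxE !addrA.
Qed.

Lemma drift_comb c k a x : chamberB° x -> 2 * k + a = 2 * (p - (N%:R - 1)) ->
  \sum_i (a * cosh (x 0 i) + drift p q k x i * sinh (x 0 i)) * comb_der c i x
  = comb_gen c x.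
Proof.
move=> xC hk; under eq_bigr do rewrite /comb_der big_distrr /=.
rewrite exchange_big /=; apply: eq_bigr => n _.
rewrite -(drift_cosh_elem n xC hk) big_distrr /=; apply: eq_bigr => i _.
by rewrite mulrCA.
Qed.

(** Subtracting the final value m/3 of phi_m gives compact support. *)
Definition test (m : R) c x : R := phi m (comb c x) - m / 3.

(** The chain rule for L phi_m(U), with L U replaced by [comb_gen]. Free of coth, it is continuous
    everywhere and provides the extension to the walls. *)
Definition test_gen (m kappa : R) c x : R :=
  ddphi m (comb c x) / kappa * (\sum_i (sinh (x 0 i) * comb_der c i x) ^+ 2)
  + dphi m (comb c x) * comb_gen c x.

Lemma C1_test m c : m != 0 ->
  C1 (test m c) (fun i x => dphi m (comb c x) * (sinh (x 0 i) * comb_der c i x)).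
Proof.
move=> m0; have C := C1_comp (fun v => is_derive_phi v m0) (@continuous_dphi R m) (C1_comb N c).
by apply: (C1_ext (C1D C (C1_cst N (- (m / 3))))) => // i x; rewrite addr0.
Qed.

Lemma C1_test_der m c i : exists2 dd,
  C1 (fun x => dphi m (comb c x) * (sinh (x 0 i) * comb_der c i x)) dd &
  forall x, dd i x = ddphi m (comb c x) * (sinh (x 0 i) * comb_der c i x) ^+ 2
    + dphi m (comb c x) * (cosh (x 0 i) * comb_der c i x).
Proof.
have [dd Cdd dd0] := @C1_comb_der R N c i.
have C := C1_comp (@is_derive_dphi R m) (@continuous_ddphi R m) (@C1_comb R N c).
eexists; first exact: (C1M C (C1M (C1_sinh_coord R i) Cdd)).
by move=> x /=; rewrite dd0 eqxx mulr0 addr0 mulr1; ring.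
Qed.

Lemma is_C2_C1 f df (ddf : 'I_N -> 'I_N -> 'rV[R]_N -> R) :
  C1 f df -> (forall i, C1 (df i) (ddf i)) ->
  is_C2 f /\ forall i j x, partial j (partial i f) x = ddf i j x.
Proof.
move=> Cf Cdf; have [f1 f2 f3] := Cf.
have p1 i : partial i f = df i by apply/funext => x; exact: f2.
have p2 i j : partial j (partial i f) = ddf i j.
  by apply/funext => x; rewrite p1; have [_ + _] := Cdf i; apply.
split; last by move=> i j x; rewrite p2.
split => [|i x|i|i j x|i j].
- exact: C1_continuous Cf.
- exact: diff_derivable.
- by rewrite p1.
- by rewrite p1; apply: diff_derivable; have [+ _ _] := Cdf i; apply.
- by rewrite p2; have [_ _] := Cdf i; apply.
Qed.

Lemma continuous_comb_gen c : continuous (comb_gen c).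
Proof.
have C (n : 'I_N.+1) (_ : true) := C1_scale (c n) (C1D
  (C1_scale (rate p q n) (C1_cosh_elem R N n))
  (C1_sum (index_enum _) (fun (m : 'I_n) (_ : true) =>
     C1_scale (coupling N p q n m) (C1_cosh_elem R N m)))).
exact: C1_continuous (C1_sum (index_enum _) C).
Qed.

Lemma in_generator_test m kappa c : 0 < m -> 0 < kappa ->
  (forall n, 0 <= c n) -> 0 < c 1%N ->
  in_generator p q kappa (test m c) (test_gen m kappa c).
Proof.
move=> m0 k0 c0 c1; have m0' : m != 0 by rewrite gt_eqF.
have /boolp.choice[dd hdd] : forall i : 'I_N, exists dd,
    C1 (fun x => dphi m (comb c x) * (sinh (x 0 i) * comb_der c i x)) dd /\
    forall x, dd i x = ddphi m (comb c x) * (sinh (x 0 i) * comb_der c i x) ^+ 2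
      + dphi m (comb c x) * (cosh (x 0 i) * comb_der c i x).
  by move=> i; have [dd ? ?] := C1_test_der m c i; exists dd.
have [C2 p2] := is_C2_C1 (C1_test c m0') (fun i => proj1 (hdd i)).
split => //.
- have cpt := @compact_comb_sublevel R N c m c0 c1.
  apply: (subclosed_compact _ cpt).
    exact: closed_closure.
  apply: closure_subset => x /=; rewrite /test; apply: contra_neqP => /negP.
  by rewrite -leNgt => mx; rewrite phi_eq_cst // subrr.
- move=> s eps x; rewrite /test /comb; congr (phi _ _ - _).
  by apply: eq_bigr => n _; rewrite cosh_elem_invariant.
- apply: continuous_subspaceT => x.
  have cc := @C1_continuous _ _ _ _ (@C1_comb R N c) x.
  have c1' := continuous_comp cc (@continuous_ddphi R m _).
  have c2' := continuous_comp cc (@continuous_dphi R m _).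
  have cs : {for x, continuous (fun x => \sum_i (sinh (x 0 i) * comb_der c i x) ^+ 2)}.
    have /boolp.choice[w Cw] : forall i, exists w,
        C1 (fun x => (sinh (x 0 i) * comb_der c i x) ^+ 2) w.
      move=> i; have [w Cw _] := @C1_comb_der R N c i.
      have CW := C1M (C1_sinh_coord R i) Cw.
      by eexists; exact: (C1M CW CW).
    exact: (@C1_continuous _ _ _ _ (C1_sum (index_enum _) (fun i (_ : true) => Cw i)) x).
  have h1 := continuousM (continuousM c1' (@cst_continuous _ _ kappa^-1 x)) cs.
  have h2 := continuousM c2' (@continuous_comb_gen c x).
  exact: (continuousD h1 h2).
(* This is where kappa leaves the first order part: 2 k_{0,2} + 1/kappa = 2 (p - (N-1)). *)
- move=> x xC; rewrite /test_gen /generator -(drift_comb c (k := k02 N p kappa) (a := kappa^-1) xC); last first.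
    by rewrite /k02; field; rewrite gt_eqF.
  rewrite !big_distrr /= -!big_split /=; apply: eq_bigr => i _.
  rewrite p2 (proj2 (hdd i)); have [_ ht _] := C1_test c m0'.
  by rewrite {1}/partial ht; ring.
Qed.

End Generator.

(** * Triangular linear systems in integral form *)

Lemma continuous_sumR (R : realType) (T : topologicalType) (I : Type) (r : seq I)
    (Q : pred I) (F : I -> T -> R) :
  (forall i, continuous (F i)) -> continuous (fun x => \sum_(i <- r | Q i) F i x).
Proof.
by move=> cF; apply: (@continuous_big _ _ _ _ _ _ _ r F) => //; exact: add_continuous.
Qed.

Section LinearSystems.
Variable R : realType.
Local Notation mu := (@lebesgue_measure R).
Implicit Types (u f F : R -> R) (t T : R).

Definition locally_bounded_measurable u : Prop := forall T,
  measurable_fun `[0, T] u /\ exists M, forall s, 0 <= s <= T -> `|u s| <= M.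

Lemma integrable_locally_bounded u t : locally_bounded_measurable u ->
  mu.-integrable `[0, t] (EFin \o u).
Proof.
move=> /(_ t)[mu_ [M bM]]; apply: measurable_bounded_integrable => //.
  rewrite /= lebesgue_measure_itv /=; case: ifPn => // _.
  by rewrite -EFinB ltry.
exists M; split; first exact: num_real.
move=> r Mr s /=; rewrite in_itv /= => hs; exact: le_trans (bM _ hs) (ltW Mr).
Qed.

Lemma locally_bounded_continuous u :
  {within `[0, +oo[, continuous u} -> locally_bounded_measurable u.
Proof.
move=> cu T; have cT : {within `[0, T], continuous u}.
  by apply: continuous_subspaceW cu => s /=; rewrite !in_itv /= => /andP[->].
split; first exact: subspace_continuous_measurable_fun.
have /compact_bounded[M [_ bM]] := continuous_compact cT (@segment_compact _ _ _).
exists (M + 1) => s hs; apply: (bM (M + 1)); first by rewrite ltrDl.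
by exists s => //=; rewrite in_itv.
Qed.

Lemma locally_bounded_ext u v : u =1 v ->
  locally_bounded_measurable u -> locally_bounded_measurable v.
Proof. by move=> /funext ->. Qed.

Lemma locally_bounded_cst c : locally_bounded_measurable (fun=> c).
Proof. by move=> T; split; [exact: measurable_cst|exists `|c|]. Qed.

Lemma locally_boundedD u v : locally_bounded_measurable u ->
  locally_bounded_measurable v -> locally_bounded_measurable (fun s => u s + v s).
Proof.
move=> hu hv T; have [mu_ [M bM]] := hu T; have [mv [M' bM']] := hv T.
split; first exact: measurable_funD.
exists (M + M') => s hs; apply: le_trans (ler_normD _ _) _.
by apply: lerD; [exact: bM|exact: bM'].
Qed.

Lemma locally_boundedZ a u : locally_bounded_measurable u ->
  locally_bounded_measurable (fun s => a * u s).
Proof.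
move=> hu T; have [mu_ [M bM]] := hu T; split.
  by apply: measurable_funM => //; exact: measurable_cst.
by exists (`|a| * M) => s hs; rewrite normrM ler_wpM2l // bM.
Qed.

Lemma locally_bounded_sum (I : Type) (r : seq I) (Q : pred I) (u : I -> R -> R) :
  (forall i, Q i -> locally_bounded_measurable (u i)) ->
  locally_bounded_measurable (fun s => \sum_(i <- r | Q i) u i s).
Proof.
move=> hu; elim: r => [|i r IH].
  by apply: locally_bounded_ext (locally_bounded_cst 0) => s; rewrite big_nil.
have [Qi|Qi] := boolP (Q i).
  by apply: locally_bounded_ext (locally_boundedD (hu _ Qi) IH) => s; rewrite big_cons Qi.
by apply: locally_bounded_ext IH => s; rewrite big_cons (negbTE Qi).
Qed.

Lemma Rintegral_derive f F t : 0 <= t ->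
  {within `[0, +oo[, continuous F} -> {within `[0, +oo[, continuous f} ->
  (forall s : R, 0 < s -> is_derive s 1 F (f s)) ->
  \int[mu]_(s in `[0, t]) f s = F t - F 0.
Proof.
rewrite le_eqVlt => /predU1P[<-|t0] cF cf dF.
  by rewrite set_itv1 Rintegral_set1 subrr.
have sub : `[0, t] `<=` `[0, +oo[ by move=> s /=; rewrite !in_itv /= => /andP[->].
have cF' := continuous_subspaceW sub cF; have cf' := continuous_subspaceW sub cf.
rewrite /Rintegral (@continuous_FTC2 _ f F 0 t) //.
- have [_ h1 h2] := (iffLR (continuous_within_itvP _ t0)) cF'.
  split => // s; rewrite in_itv /= => /andP[s0 _]; by have [] := dF s s0.
- move=> s; rewrite in_itv /= => /andP[s0 _].
  by rewrite derive1E; exact: (@derive_val _ _ _ _ _ _ _ (dF s s0)).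
Qed.

Lemma Rintegral_expR a t : a != 0 -> 0 <= t ->
  \int[mu]_(s in `[0, t]) expR (a * s) = (expR (a * t) - 1) / a.
Proof.
move=> a0 t0.
have dF (s : R) : is_derive s 1 (fun s => expR (a * s) / a) (expR (a * s)).
  apply: is_derive_eq; rewrite /GRing.scale /=; field; exact: a0.
have cE : continuous (fun s : R => expR (a * s)).
  by move=> s; apply: (@continuous_comp _ _ _ ( *%R a) expR); [exact: mulrl_continuous|exact: continuous_expR].
rewrite (@Rintegral_derive _ (fun s => expR (a * s) / a)) //.
- by rewrite mulr0 expR0 mulrBl.
- apply: continuous_subspaceT => s; apply: differentiable_continuous.
  by apply/derivable1_diffP; have [] := dF s.
- exact: continuous_subspaceT.
Qed.

(** With the weight e^{-2Cs} the integral term costs at most half of the weighted supremum M, so M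
    <= A + M_+ / 2 and hence M <= 2A. Boundedness of u makes M finite. *)
Lemma gronwall u A C T : 0 <= A -> 0 < C -> locally_bounded_measurable u ->
  (forall t, 0 <= t <= T -> u t <= A + C * \int[mu]_(s in `[0, t]) u s) ->
  forall t, 0 <= t <= T -> u t <= 2 * A * expR (2 * C * t).
Proof.
move=> A0 C0 hu hle t tT; have [t0 _] := andP tT; have T0 : 0 <= T by lra.
pose S := [set u s * expR (- (2 * C * s)) | s in `[0, T]%classic].
have S0 : S !=set0 by exists (u t * expR (- (2 * C * t))); exists t.
have bS : has_ubound S.
  have [_ [M bM]] := hu T; exists M => _ [s /= + <-]; rewrite in_itv /= => hs.
  have [s0 _] := andP hs.
  apply: le_trans (ler_norm _) _; rewrite normrM (gtr0_norm (expR_gt0 _)).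
  apply: le_trans (_ : `|u s| * 1 <= _); last by rewrite mulr1 bM.
  by rewrite ler_wpM2l // -[leRHS]expR0 ler_expR oppr_le0 !mulr_ge0 // ltW.
set M := sup S.
have uM s : 0 <= s <= T -> u s <= M * expR (2 * C * s).
  move=> hs; rewrite -ler_pdivrMr ?expR_gt0 // -expRN.
  by apply: ub_le_sup => //; exists s.
have C2 : 2 * C != 0 by rewrite mulf_neq0 // gt_eqF.
(* The positive part is taken because u, and so M, may be negative. *)
have Mle : M <= A + Num.max 0 M / 2.
  apply: ge_sup => // _ [s /= + <-]; rewrite in_itv /= => hs; have [s0 _] := andP hs.
  rewrite expRN ler_pdivrMr ?expR_gt0 //; apply: le_trans (hle _ hs) _.
  have le1 : \int[mu]_(r in `[0, s]) u r
      <= Num.max 0 M * ((expR (2 * C * s) - 1) / (2 * C)).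
    have hE : locally_bounded_measurable (fun r => expR (2 * C * r)).
      apply: locally_bounded_continuous; apply: continuous_subspaceT => r.
      by apply: (@continuous_comp _ _ _ ( *%R (2 * C)) expR); [exact: mulrl_continuous|exact: continuous_expR].
    rewrite -Rintegral_expR // -RintegralZl //; last exact: integrable_locally_bounded.
    apply: le_Rintegral => //.
    - exact: integrable_locally_bounded.
    - exact/integrable_locally_bounded/locally_boundedZ.
    - move=> r /=; rewrite in_itv /= => /andP[r0 rs].
      apply: le_trans (uM r _) _; first by rewrite r0 (le_trans rs) //; have [] := andP hs.
      by rewrite ler_wpM2r ?expR_ge0 // le_max lexx orbT.
  apply: le_trans (lerD (lexx A) (ler_wpM2l (ltW C0) le1)) _.
  have E1 : 1 <= expR (2 * C * s) by rewrite -expR0 ler_expR !mulr_ge0 // ltW.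
  have -> : C * (Num.max 0 M * ((expR (2 * C * s) - 1) / (2 * C)))
      = Num.max 0 M / 2 * (expR (2 * C * s) - 1) by field; rewrite gt_eqF.
  have M0 : 0 <= Num.max 0 M by rewrite le_max lexx.
  set E := expR _ in E1 *; set K := Num.max 0 M in M0 *; nra.
apply: le_trans (uM t tT) _; rewrite ler_wpM2r ?expR_ge0 //.
by move: Mle; rewrite /Num.max; case: ltP; lra.
Qed.

Section Triangular.
Variables (r : nat -> R) (beta : nat -> nat -> R).

Definition exp_comb (a : nat -> nat -> R) n t : R :=
  \sum_(l < n.+1) a n l * expR (r l * t).

(** The initial value, and the comparison of the coefficients of e^{r_l t} in the n-th equation for
    l < n; for l = n they agree automatically. The restriction l <= m reflects that row m has no
    entries beyond m. *)
Definition exp_coefficients (x0 : nat -> R) N (a : nat -> nat -> R) : Prop :=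
  forall n, (n <= N)%N ->
    \sum_(l < n.+1) a n l = x0 n /\
    forall l, (l < n)%N ->
      r l * a n l = r n * a n l + \sum_(m < n | (l <= m)%N) beta n m * a m l.

(* Undetermined coefficients, solved row by row: since the exponents are
   distinct, the entries l < n of row n are forced by the previous rows, and
   the last one by the initial value. *)
Lemma exists_exp_coefficients (x0 : nat -> R) N :
  (forall l n, (l < n)%N -> (n <= N)%N -> r l != r n) ->
  exists a, exp_coefficients x0 N a.
Proof.
elim: N => [|N IH] rN.
  exists (fun _ _ => x0 0%N) => n; rewrite leqn0 => /eqP ->.
  by split => //; rewrite big_ord1.
have [l n ln nN|a ha] := IH; first by apply: rN => //; exact: leqW.
pose s l := (\sum_(m < N.+1 | (l <= m)%N) beta N.+1 m * a m l) / (r l - r N.+1).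
pose a' n l := if (n <= N)%N then a n l
  else if (l < N.+1)%N then s l else x0 N.+1 - \sum_(l < N.+1) s l.
exists a' => n; rewrite leq_eqVlt => /predU1P[->|]; last first.
  rewrite ltnS => nN; have [h1 h2] := ha n nN; split.
    by rewrite -h1; apply: eq_bigr => l _; rewrite /a' nN.
  move=> l ln; rewrite /a' nN h2 //; congr (_ + _); apply: eq_bigr => m _.
  by rewrite (leq_trans (ltnW (ltn_ord m)) nN).
split.
  rewrite big_ord_recr /= /a' ltnn ltnn.
  rewrite [X in X + _ = _](eq_bigr (fun l : 'I_N.+1 => s l)); first by rewrite addrC subrK.
  by move=> l _; rewrite ltn_ord.
move=> l lN; rewrite /a' ltnn lN.
have rl : r l - r N.+1 != 0 by rewrite subr_eq0 rN.
apply: (@addrI _ (- (r N.+1 * s l))); rewrite addKr addrC -mulrBl.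
rewrite /s mulrC divfK //; apply: eq_bigr => m _.
by rewrite -ltnS ltn_ord.
Qed.

Lemma continuous_exp_comb a n : continuous (exp_comb a n).
Proof.
apply: continuous_sumR => l t; apply: cvgMr.
by apply: (@continuous_comp _ _ _ ( *%R (r l)) expR); [exact: mulrl_continuous|exact: continuous_expR].
Qed.

Lemma locally_bounded_exp_comb a n : locally_bounded_measurable (exp_comb a n).
Proof.
by apply: locally_bounded_continuous; apply: continuous_subspaceT; exact: continuous_exp_comb.
Qed.

Lemma exp_comb_integral a x0 N n t :
  exp_coefficients x0 N a ->
  (n <= N)%N -> 0 <= t ->
  exp_comb a n t = x0 n + \int[mu]_(s in `[0, t])
    (r n * exp_comb a n s + \sum_(m < n) beta n m * exp_comb a m s).
Proof.
move=> ha nN t0; have [h1 h2] := ha n nN.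
suff -> : \int[mu]_(s in `[0, t])
    (r n * exp_comb a n s + \sum_(m < n) beta n m * exp_comb a m s)
    = exp_comb a n t - exp_comb a n 0.
  rewrite -h1 [X in _ = _ + (_ - X)](_ : _ = \sum_(l < n.+1) a n l); first by rewrite addrC subrK.
  by apply: eq_bigr => l _; rewrite mulr0 expR0 mulr1.
apply: Rintegral_derive => //.
- exact/continuous_subspaceT/continuous_exp_comb.
- apply: continuous_subspaceT => s.
  have c1 := continuousM (@cst_continuous _ _ (r n) s) (@continuous_exp_comb a n s).
  have c2 : continuous (fun s => \sum_(m < n) beta n m * exp_comb a m s).
    by apply: continuous_sumR => m u; apply: cvgMr; exact: continuous_exp_comb.
  exact: continuousD c1 (c2 s).
- move=> s _.
  have dE l : is_derive s 1 (fun t : R => a n l * expR (r l * t)) (r l * a n l * expR (r l * s)).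
    by apply: is_derive_eq; rewrite /GRing.scale /=; ring.
  have -> : exp_comb a n = \sum_(l < n.+1) (fun t : R => a n l * expR (r l * t)).
    by apply/funext => u; rewrite fct_sumE.
  apply: is_derive_eq.
  (* Collected by exponentials, the two sides can be compared term by term through [h2]. *)
  have -> : \sum_(m < n) beta n m * exp_comb a m s
      = \sum_(l < n) (\sum_(m < n | (l <= m)%N) beta n m * a m l) * expR (r l * s).
    under [RHS]eq_bigr do rewrite big_distrl /=.
    rewrite [RHS](exchange_big_dep xpredT) //=; apply: eq_bigr => m _.
    rewrite /exp_comb big_distrr /= (big_ord_widen n (fun l => beta n m * (a m l * expR (r l * s)))) //.
    by apply: eq_big => [l|l _]; rewrite ?ltnS // mulrA.
  rewrite /exp_comb big_ord_recr [in RHS]big_ord_recr /= mulrDr [RHS]addrAC mulrA.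
  congr (_ + _); rewrite fct_sumE mulr_sumr -big_split; apply: eq_bigr => l _ /=.
  by rewrite h2 // mulrDl mulrA.
Qed.

(** [gronwall] for |w| with A = 0; its rate is |c| + 1 in order to be positive also for c = 0. *)
Lemma linear_integral_unique (w : R -> R) c :
  locally_bounded_measurable w ->
  (forall t, 0 <= t -> w t = c * \int[mu]_(s in `[0, t]) w s) ->
  forall t, 0 <= t -> w t = 0.
Proof.
move=> hw wE t t0; apply/normr0_eq0/le_anti; rewrite normr_ge0 andbT.
have hn : locally_bounded_measurable (fun s => `|w s|).
  move=> T; have [mw [M bM]] := hw T; split; first exact: measurableT_comp.
  by exists M => s hs; rewrite normr_id bM.
have := @gronwall _ 0 (`|c| + 1) t (lexx _) _ hn _ t; rewrite mulr0 mul0r.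
apply; [|move=> s /andP[s0 _]|by rewrite t0 lexx]; first by rewrite ltr_pwDr.
rewrite add0r [in leLHS]wE // normrM.
have le1 : `|\int[mu]_(s in `[0, s]) w s| <= \int[mu]_(s in `[0, s]) `|w s|.
  by apply: le_normr_Rintegral => //; exact: integrable_locally_bounded.
apply: (le_trans (ler_wpM2l (normr_ge0 c) le1)).
by rewrite ler_wpM2r ?lerDl // Rintegral_ge0.
Qed.

(** By strong induction the lower rows agree, so the difference w in row n satisfies w = r_n times
    the integral of w. *)
Lemma triangular_system_unique a x0 N (u : nat -> R -> R) :
  exp_coefficients x0 N a ->
  (forall n, (n <= N)%N -> locally_bounded_measurable (u n)) ->
  (forall n t, (n <= N)%N -> 0 <= t ->
    u n t = x0 n + \int[mu]_(s in `[0, t])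
      (r n * u n s + \sum_(m < n) beta n m * u m s)) ->
  forall n t, (n <= N)%N -> 0 <= t -> u n t = exp_comb a n t.
Proof.
move=> ha hu uE; elim/ltn_ind => n IH t nN t0; apply/eqP; rewrite -subr_eq0.
have hw : locally_bounded_measurable (fun s => u n s - exp_comb a n s).
  have := locally_boundedD (hu n nN) (locally_boundedZ (-1) (@locally_bounded_exp_comb a n)).
  by apply: locally_bounded_ext => s; rewrite mulN1r.
apply/eqP; apply: (@linear_integral_unique (fun s => u n s - exp_comb a n s) (r n)) => //.
move=> {t0} t t0; rewrite uE // (exp_comb_integral ha nN t0) opprD addrACA subrr add0r.
have hl (v : nat -> R -> R) : (forall m, (m <= n)%N -> locally_bounded_measurable (v m)) ->
    locally_bounded_measurable (fun s => r n * v n s + \sum_(m < n) beta n m * v m s).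
  move=> hv; apply: locally_boundedD; first exact/locally_boundedZ/hv.
  by apply: locally_bounded_sum => m _; apply/locally_boundedZ/hv/ltnW.
rewrite -RintegralB //; last 2 first.
- by apply: integrable_locally_bounded; apply: hl => m mn; exact/hu/(leq_trans mn).
- by apply: integrable_locally_bounded; apply: hl => m mn; exact: locally_bounded_exp_comb.
rewrite -RintegralZl //; last exact: integrable_locally_bounded.
apply: eq_Rintegral => s; rewrite inE /= in_itv /= => /andP[s0 _].
rewrite (eq_bigr (fun m : 'I_n => beta n m * exp_comb a m s)); first ring.
by move=> m _; rewrite IH // (leq_trans (ltnW (ltn_ord m)) nN).
Qed.

End Triangular.

End LinearSystems.

(** * Joint measurability and exchange of integrals *)

Section Caratheodory.
Context (R : realType) (d : measure_display) (T : measurableType d).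
Variable f : R -> T -> R.
Hypothesis mf : forall s, 0 <= s -> measurable_fun setT (f s).
Hypothesis cf : forall w, {within `[0, +oo[, continuous (f ^~ w)}.

(** Sampling in time on the grid of mesh 1/(k+1): a countable union of rectangles describes each
    preimage. Truncation sends negative times to 0, so the limit is taken at max(0, s). *)
Let approx (k : nat) (z : T * R) : R :=
  f ((Num.truncn (k.+1%:R * z.2))%:R / k.+1%:R) z.1.

Lemma measurable_truncn_eq (c : R) j : measurable [set s : R | Num.truncn (c * s) = j].
Proof.
have mle i : measurable [set s : R | (Num.truncn (c * s) <= i)%N].
  rewrite (_ : [set _ | _] = [set s | c * s < i.+1%:R]); last first.
    by apply/seteqP; split => s /=; rewrite truncn_le_nat.
  rewrite -[X in measurable X]setTI.
  have mc : measurable_fun setT (fun s : R => c * s) by exact: measurable_funM.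
  by have := mc measurableT _ (measurable_itv `]-oo, i.+1%:R[); congr measurable; apply/seteqP; split => s /=; rewrite in_itv.
case: j => [|j].
  by have := mle 0%N; congr measurable; apply/seteqP; split => s /=; rewrite leqn0 => /eqP.
rewrite (_ : [set _ | _] = [set s | (Num.truncn (c * s) <= j.+1)%N] `\` [set s | (Num.truncn (c * s) <= j)%N]).
  exact: measurableD.
apply/seteqP; split => s /= => [->|[h1 /negP]]; first by rewrite leqnn ltnn.
by rewrite -ltnNge => h2; apply/eqP; rewrite eqn_leq h1.
Qed.

Let measurable_approx k : measurable_fun setT (approx k).
Proof.
move=> _ B mB; rewrite setTI.
rewrite (_ : _ @^-1` _ = \bigcup_(j in [set: nat])
  ((f (j%:R / k.+1%:R) @^-1` B) `*` [set s | Num.truncn (k.+1%:R * s) = j])).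
  apply: bigcup_measurable => j _; apply: measurableX; last exact: measurable_truncn_eq.
  by rewrite -[X in measurable X]setTI; apply: mf => //; rewrite divr_ge0.
apply/seteqP; split => [[w s] /= fB|[w s] [j _ [/= fB hj]]]; last by rewrite /approx /= hj.
by exists (Num.truncn (k.+1%:R * s)).
Qed.

Lemma cvg_truncn_div (s : R) :
  (Num.truncn (k.+1%:R * s))%:R / k.+1%:R @[k --> \oo] --> Num.max 0 s.
Proof.
have [s0|s0] := leP s 0.
  rewrite (_ : (fun _ => _) = fun=> 0); first exact: cvg_cst.
  apply/funext => k; suff -> : Num.truncn (k.+1%:R * s) = 0%N by rewrite mul0r.
  by apply/eqP; rewrite -leqn0 truncn_le_nat (le_lt_trans _ ltr01) // mulr_ge0_le0.
have bnd k : s - k.+1%:R^-1 <= (Num.truncn (k.+1%:R * s))%:R / k.+1%:R <= s.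
  have k0 : 0 < k.+1%:R :> R by rewrite ltr0n.
  have /truncn_itv/andP[h1 h2] : 0 <= k.+1%:R * s by rewrite mulr_ge0 // ltW.
  rewrite ler_pdivrMr // [s * _]mulrC h1 andbT ler_pdivlMr // mulrBl mulVf ?gt_eqF //.
  by rewrite lerBlDr natr1 mulrC ltW.
apply: (@squeeze_cvgr _ _ _ _ (fun k => s - k.+1%:R^-1) (fun=> s)).
- by near=> k; exact: bnd.
- rewrite -[X in _ --> X]subr0; apply: cvgB; first exact: cvg_cst.
  exact: cvg_harmonic.
- exact: cvg_cst.
Unshelve. all: by end_near. Qed.

Lemma measurable_fun_caratheodory :
  measurable_fun setT (fun z : T * R => f (Num.max 0 z.2) z.1).
Proof.
apply: (measurable_fun_cvg measurable_approx) => -[w s] _ /=.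
have s0 : `[0, +oo[%classic (Num.max 0 s) by rewrite /= in_itv /= andbT le_max lexx.
have c0 := iffLR (subspace_continuousP _ _) (cf (w := w)) _ s0.
apply: cvg_comp c0 => U /= hU.
pose g (k : nat) : R := (Num.truncn (k.+1%:R * s))%:R / k.+1%:R.
(* Paths are continuous only within the half-line; the grid points stay there. *)
have : \forall k \near \oo, `[0, +oo[%classic (g k) -> U (g k) := @cvg_truncn_div s _ hU.
by apply: filterS => k; apply; rewrite /= in_itv /= andbT divr_ge0.
Qed.

End Caratheodory.

Section BoundedFubini.
Context (R : realType) (d : measure_display) (T : measurableType d).
Variable P : probability T R.
Local Notation mu := (@lebesgue_measure R).

Lemma integrable_bounded (F : T -> R) K : measurable_fun setT F ->
  (forall w, `|F w| <= K) -> P.-integrable setT (EFin \o F).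
Proof.
move=> mF bF; apply: measurable_bounded_integrable => //.
  by rewrite ltey_eq fin_num_measure.
exists K; split; first exact: num_real.
by move=> r Kr w _; exact: le_trans (bF w) (ltW Kr).
Qed.

Lemma Rintegral_probability_cst (r : R) : \int[P]_(_ in setT) r = r.
Proof.
by rewrite Rintegral_cst // [X in fine X](_ : _ = 1%E) ?mulr1 //; exact: probability_setT.
Qed.

Lemma normr_expectation_le (F : T -> R) K : measurable_fun setT F ->
  (forall w, `|F w| <= K) -> `|\int[P]_w F w| <= K.
Proof.
move=> mF bF; apply: le_trans (le_normr_Rintegral _ (integrable_bounded mF bF)) _ => //.
rewrite -[leRHS]Rintegral_probability_cst.
apply: le_Rintegral => //.
- by apply: (@integrable_bounded _ K) => [|w]; [exact: measurableT_comp|rewrite normr_id].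
- exact: (@integrable_bounded _ `|K|).
Qed.

Variables (G : T * R -> R) (K : R).
Hypotheses (mG : measurable_fun setT G) (bG : forall z, `|G z| <= K).

Let K0 : 0 <= K.
Proof. exact: le_trans (normr_ge0 _) (bG (point, 0)). Qed.

(** The indicator makes the bounded G integrable for the product with Lebesgue measure on the whole
    line, to which Fubini applies. *)
Let Gt (t : R) (z : T * R) : \bar R := (G z * \1_(`[0, t]%classic) z.2)%:E.

Let measurable_Gt t : measurable_fun setT (Gt t).
Proof.
apply/measurable_EFinP; apply: measurable_funM => //.
exact: measurableT_comp.
Qed.

Let integrable_Gt t : (P \x mu)%E.-integrable setT (Gt t).
Proof.
apply/integrable12ltyP; first exact: measurable_Gt.
have mabs := measurableT_comp (@abse_measurable R setT) (measurable_Gt t).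
have fin : (\int[P]_w (K%:E * mu `[0%R, t]%classic) < +oo)%E.
  rewrite integral_cst // lebesgue_measure_itv /= probability_setT mule1.
  by case: ifP => _; rewrite ?mule0 // -EFinB -EFinM ltry.
apply: le_lt_trans fin; apply: ge0_le_integral => //.
- by move=> w _; exact: integral_ge0.
- by apply: (@measurable_fun_fubini_tonelli_F _ _ _ _ _ mu (abse \o Gt t) mabs) => z; exact: abse_ge0.
- move=> w _; rewrite -(@integral_cst _ _ _ mu) // [leRHS]integral_mkcond.
  apply: ge0_le_integral => //.
  + exact: (measurableT_comp mabs).
  + by apply/(measurable_restrictT _ _).1.
  + move=> s _; rewrite patchE /Gt /= indicE.
    by case: (s \in _); rewrite ?mulr1 ?mulr0 ?normr0 // lee_fin.
Qed.

Lemma measurable_section2 w : measurable_fun setT (fun s : R => G (w, s)).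
Proof. exact: (measurableT_comp mG). Qed.

Lemma measurable_section1 s : measurable_fun setT (fun w => G (w, s)).
Proof. exact: (measurableT_comp mG). Qed.

Lemma locally_bounded_section w : locally_bounded_measurable (fun s => G (w, s)).
Proof.
move=> t; split; last by exists K => s _.
exact: measurable_funS (measurable_section2 w).
Qed.

Let time_integralE t w :
  (\int[mu]_(s in `[0, t]) G (w, s))%:E = (\int[mu]_s Gt t (w, s))%E.
Proof.
rewrite fineK; last first.
  apply: integrable_fin_num => //.
  exact/integrable_locally_bounded/locally_bounded_section.
rewrite integral_mkcond; apply: eq_integral => s _.
by rewrite patchE /Gt /= indicE; case: (s \in _); rewrite ?mulr1 ?mulr0.
Qed.

Let expectationE t s : 0 <= s <= t ->
  (\int[P]_w G (w, s))%:E = (\int[P]_w Gt t (w, s))%E.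
Proof.
move=> hs; rewrite fineK; last first.
  apply: integrable_fin_num => //.
  exact: integrable_bounded (measurable_section1 s) (fun w => bG (w, s)).
by apply: eq_integral => w _; rewrite /Gt /= indicE mem_set ?mulr1 //= in_itv.
Qed.

Lemma locally_bounded_expectation : locally_bounded_measurable (fun s => \int[P]_w G (w, s)).
Proof.
move=> t; split.
  have m1 := measurable_fubini_G (integrable_Gt t).
  apply/measurable_EFinP; apply: (eq_measurable_fun (fun s => \int[P]_w Gt t (w, s))%E).
    by move=> s; rewrite inE /= in_itv /= => hs; rewrite -(expectationE hs).
  exact: measurable_funS m1.
exists K => s _.
exact: normr_expectation_le (measurable_section1 s) (fun w => bG (w, s)).
Qed.

Lemma integrable_time_integral t : 0 <= t ->
  P.-integrable setT (EFin \o (fun w => \int[mu]_(s in `[0, t]) G (w, s))).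
Proof.
move=> t0; have m1 := integrable_fubini_F (integrable_Gt t).
by apply: eq_integrable m1 => // w _; rewrite /= time_integralE.
Qed.

Lemma Fubini_bounded t :
  \int[P]_w \int[mu]_(s in `[0, t]) G (w, s) = \int[mu]_(s in `[0, t]) \int[P]_w G (w, s).
Proof.
rewrite {1}/Rintegral [in RHS]/Rintegral; congr fine.
under eq_integral do rewrite time_integralE.
rewrite (Fubini (integrable_Gt t)) [RHS]integral_mkcond; apply: eq_integral => s _.
rewrite patchE; case: ifPn => [|hs].
  by rewrite inE /= in_itv /= => hs; rewrite -(expectationE hs).
apply: integral0_eq => w _; rewrite /Gt /= indicE; move: hs; case: (s \in _) => // _.
by rewrite mulr0.
Qed.

End BoundedFubini.

(** * Bounds and limits for the truncated functions *)

Section Bounds.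
Variables (R : realType) (N : nat) (p q : R).
Implicit Types (x : 'rV[R]_N) (c : nat -> R) (m kappa : R).

Definition gen_bound c : R :=
  \sum_(n < N.+1) c n * (`|rate p q n| + \sum_(m < n) `|coupling N p q n m|).

Lemma cosh_elem_le_comb c n x : (forall n, 1 <= c n) -> (n <= N)%N ->
  cosh_elem n x <= comb c x.
Proof.
move=> c1 nN; have c0 k : 0 <= c k := le_trans ler01 (c1 k).
rewrite /comb (bigD1 (inord n)) //= inordK ?ltnS //.
apply: (@le_trans _ _ (c n * cosh_elem n x)).
  by rewrite ler_peMl // cosh_elem_ge0.
by rewrite lerDl; apply: sumr_ge0 => k _; rewrite mulr_ge0 ?cosh_elem_ge0.
Qed.

Lemma gen_bound_ge0 c : (forall n, 1 <= c n) -> 0 <= gen_bound c.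
Proof.
move=> c1; apply: sumr_ge0 => n _; rewrite mulr_ge0 ?(le_trans ler01 (c1 n)) //.
by rewrite addr_ge0 // sumr_ge0.
Qed.

(** Coefficients at least 1 make U dominate each E_m, in particular those that the coupling brings
    in. *)
Lemma norm_comb_gen_le c x : (forall n, 1 <= c n) ->
  `|comb_gen p q c x| <= gen_bound c * comb c x.
Proof.
move=> c1; have c0 k : 0 <= c k := le_trans ler01 (c1 k).
apply: le_trans (ler_norm_sum _ _ _) _; rewrite mulr_suml; apply: ler_sum => n _.
rewrite normrM ger0_norm // -mulrA; apply: ler_wpM2l => //.
apply: le_trans (ler_normD _ _) _; rewrite mulrDl; apply: lerD.
  rewrite normrM (ger0_norm (cosh_elem_ge0 _ _)); apply: ler_wpM2l => //.
  by apply: cosh_elem_le_comb => //; rewrite -ltnS.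
apply: le_trans (ler_norm_sum _ _ _) _; rewrite mulr_suml; apply: ler_sum => k _.
rewrite normrM (ger0_norm (cosh_elem_ge0 _ _)); apply: ler_wpM2l => //.
by apply: cosh_elem_le_comb => //; rewrite -ltnS (ltn_trans (ltn_ord k)).
Qed.

Definition sq_grad c x : R := \sum_i (sinh (x 0 i) * comb_der c i x) ^+ 2.

Lemma sq_grad_ge0 c x : 0 <= sq_grad c x.
Proof. by apply: sumr_ge0 => i _; exact: sqr_ge0. Qed.

Lemma sq_grad_le c x : (forall n, 1 <= c n) -> sq_grad c x <= N%:R * comb c x ^+ 2.
Proof.
move=> c1; have c0 k : 0 <= c k := le_trans ler01 (c1 k).
rewrite -[N in N%:R]card_ord mulr_natl -sumr_const; apply: ler_sum => i _.
rewrite -real_normK ?num_real // ler_sqr ?nnegrE ?comb_ge0 //.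
exact: norm_comb_der_le.
Qed.

(** The constant is independent of m: this is the domination by U for the limit of large m. *)
Lemma norm_test_gen_le m kappa c x : 0 < m -> 0 < kappa -> (forall n, 1 <= c n) ->
  `|test_gen p q m kappa c x| <= (2 * N%:R / kappa + gen_bound c) * comb c x.
Proof.
move=> m0 k0 c1; have c0 k : 0 <= c k := le_trans ler01 (c1 k).
have U0 := comb_ge0 x c0.
rewrite /test_gen -/(sq_grad c x) mulrDl; apply: le_trans (ler_normD _ _) _; apply: lerD.
  rewrite normrM (ger0_norm (sq_grad_ge0 _ _)) normrM normfV (gtr0_norm k0).
  apply: le_trans (ler_wpM2l _ (sq_grad_le x c1)) _; first by rewrite divr_ge0 // ltW.
  have -> : `|ddphi m (comb c x)| / kappa * (N%:R * comb c x ^+ 2)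
     = N%:R / kappa * comb c x * (`|ddphi m (comb c x)| * comb c x) by ring.
  have -> : 2 * N%:R / kappa * comb c x = N%:R / kappa * comb c x * 2 by ring.
  apply: ler_wpM2l; last exact: norm_ddphi_le.
  by rewrite mulr_ge0 // divr_ge0 // ltW.
rewrite normrM (ger0_norm (dphi_ge0 _ _)).
apply: le_trans (norm_comb_gen_le x c1); rewrite ler_piMl //.
exact: dphi_le1.
Qed.

(** For fixed m the function vanishes where U >= m; boundedness gives Fubini before any moment is
    known. *)
Lemma norm_test_gen_bounded m kappa c x : 0 < m -> 0 < kappa -> (forall n, 1 <= c n) ->
  `|test_gen p q m kappa c x| <= (2 * N%:R / kappa + gen_bound c) * m.
Proof.
move=> m0 k0 c1; have K0 : 0 <= 2 * N%:R / kappa + gen_bound c.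
  by rewrite addr_ge0 ?gen_bound_ge0 // divr_ge0 // ?mulr_ge0 // ltW.
have [mU|Um] := leP m (comb c x).
  rewrite /test_gen dphi_eq0 // ddphi_eq0 // !mul0r addr0 normr0.
  by rewrite mulr_ge0 // ltW.
apply: le_trans (norm_test_gen_le x m0 k0 c1) _.
by apply: ler_wpM2l => //; exact: ltW.
Qed.

(** Concavity is used twice: the second order term is nonpositive, and [dphi_mul_le] brings back
    phi_m. *)
Lemma test_gen_le m kappa c x : 0 < m -> 0 < kappa -> (forall n, 1 <= c n) ->
  test_gen p q m kappa c x <= gen_bound c * phi m (comb c x).
Proof.
move=> m0 k0 c1; have c0 k : 0 <= c k := le_trans ler01 (c1 k).
rewrite /test_gen -/(sq_grad c x) -[leRHS]add0r; apply: lerD.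
  rewrite mulr_le0_ge0 ?sq_grad_ge0 // mulr_le0_ge0 ?ddphi_le0 //.
  by rewrite invr_ge0 ltW.
apply: (@le_trans _ _ (dphi m (comb c x) * (gen_bound c * comb c x))).
  apply: ler_wpM2l; first exact: dphi_ge0.
  exact: le_trans (ler_norm _) (norm_comb_gen_le x c1).
rewrite mulrCA; apply: ler_wpM2l; first exact: gen_bound_ge0.
by apply: dphi_mul_le => //; exact: comb_ge0.
Qed.

Lemma cvg_harmonic_bound (u : nat -> R) l C :
  (forall k, `|u k - l| <= C / k.+1%:R) -> u k @[k --> \oo] --> l.
Proof.
move=> hu; apply/subr_cvg0; apply/norm_cvg0P.
apply: (@squeeze_cvgr _ _ _ _ (fun=> 0) (fun k => C / k.+1%:R)).
- by near=> k; rewrite normr_ge0 hu.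
- exact: cvg_cst.
- rewrite -[X in _ --> X](mulr0 C); apply: cvgM; first exact: cvg_cst.
  exact: cvg_harmonic.
Unshelve. all: by end_near. Qed.

Lemma cvg_phi (v : R) : 0 <= v -> phi k.+1%:R v @[k --> \oo] --> v.
Proof.
move=> v0; apply: (@cvg_harmonic_bound _ _ (v ^+ 2)) => k.
have k0 : 0 < k.+1%:R :> R by rewrite ltr0n.
set m : R := k.+1%:R in k0 *; have := phi_le k0 v0; have := phi_ge k0 v0 => h1 h2.
by rewrite ler0_norm ?subr_le0 // opprB lerBlDl -lerBlDr.
Qed.

Lemma cvg_test_gen kappa c x : 0 < kappa -> (forall n, 1 <= c n) ->
  test_gen p q k.+1%:R kappa c x @[k --> \oo] --> comb_gen p q c x.
Proof.
move=> k0 c1; have c0 k : 0 <= c k := le_trans ler01 (c1 k).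
have U0 := comb_ge0 x c0.
apply: (@cvg_harmonic_bound _ _ (2 / kappa * sq_grad c x + 2 * comb c x * `|comb_gen p q c x|)) => k.
have m0 : 0 < k.+1%:R :> R by rewrite ltr0n.
set m : R := k.+1%:R in m0 *; rewrite /test_gen -/(sq_grad c x).
have -> : ddphi m (comb c x) / kappa * sq_grad c x + dphi m (comb c x) * comb_gen p q c x
    - comb_gen p q c x
  = ddphi m (comb c x) / kappa * sq_grad c x + (dphi m (comb c x) - 1) * comb_gen p q c x.
  by ring.
apply: le_trans (ler_normD _ _) _; rewrite [leRHS]mulrDl; apply: lerD.
  rewrite normrM (ger0_norm (sq_grad_ge0 _ _)) normrM normfV (gtr0_norm k0).
  have -> : 2 / kappa * sq_grad c x / m = 2 / m / kappa * sq_grad c x by ring.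
  apply: ler_wpM2r; first exact: sq_grad_ge0.
  by apply: ler_wpM2r; [rewrite invr_ge0 ltW|exact: norm_ddphi_le_inv].
rewrite normrM [leRHS]mulrAC; apply: ler_wpM2r => //.
have := dphi_le1 m0 U0; have := dphi_ge (comb c x) m0 => h1 h2.
by rewrite ler0_norm ?subr_le0 // opprB lerBlDl -lerBlDr.
Qed.

End Bounds.

(** * Measurability of the functionals of a random point *)

Section MeasurableFunctionals.
Context (R : realType) (N : nat) (p q : R) (d : measure_display) (S : measurableType d).
Variable xi : S -> 'rV[R]_N.
Hypothesis mxi : forall i, measurable_fun setT (fun z => xi z 0 i).

Let measurable_cosh_prod (h : {set 'I_N}) (Q : pred 'I_N) :
  measurable_fun setT (fun z => \prod_(k in h | Q k) cosh_vec (xi z) 0 k).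
Proof.
under eq_fun do rewrite -big_filter.
apply: measurable_prod => k _; under eq_fun do rewrite mxE.
by apply: measurableT_comp => //; exact: continuous_measurable_fun (@continuous_cosh R).
Qed.

Lemma measurable_cosh_elem n : measurable_fun setT (fun z => cosh_elem n (xi z)).
Proof.
rewrite /cosh_elem /elem_sym; under eq_fun do rewrite -big_filter.
apply: measurable_sum => h.
have := measurable_cosh_prod h xpredT; by under eq_fun do under eq_bigl do rewrite andbT.
Qed.

Lemma measurable_cosh_elem_der i n : measurable_fun setT (fun z => cosh_elem_der i n (xi z)).
Proof.
rewrite /cosh_elem_der /elem_sym_der; under eq_fun do rewrite -big_filter.
by apply: measurable_sum => h.
Qed.

Lemma measurable_comb c : measurable_fun setT (fun z => comb c (xi z)).
Proof.
apply: measurable_sum => n; apply: measurable_funM => //.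
exact: measurable_cosh_elem.
Qed.

Lemma measurable_comb_gen c : measurable_fun setT (fun z => comb_gen p q c (xi z)).
Proof.
apply: measurable_sum => n; apply: measurable_funM => //; apply: measurable_funD.
  by apply: measurable_funM => //; exact: measurable_cosh_elem.
by apply: measurable_sum => m; apply: measurable_funM => //; exact: measurable_cosh_elem.
Qed.

Lemma measurable_phi_comb m c : m != 0 -> measurable_fun setT (fun z => phi m (comb c (xi z))).
Proof.
move=> m0; apply: (measurableT_comp _ (measurable_comb c)).
apply: continuous_measurable_fun => v; apply: differentiable_continuous.
by apply/derivable1_diffP; have [] := is_derive_phi v m0.
Qed.

Lemma measurable_test_gen m kappa c :
  measurable_fun setT (fun z => test_gen p q m kappa c (xi z)).
Proof.
apply: measurable_funD; apply: measurable_funM.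
- apply: measurable_funM => //; apply: (measurableT_comp _ (measurable_comb c)).
  exact: continuous_measurable_fun (@continuous_ddphi R m).
- apply: measurable_sum => i; apply: measurable_funX; apply: measurable_funM.
    apply: measurableT_comp => //.
    exact: continuous_measurable_fun (@continuous_sinh R).
  apply: measurable_sum => n; apply: measurable_funM => //.
  exact: measurable_cosh_elem_der.
- apply: (measurableT_comp _ (measurable_comb c)).
  exact: continuous_measurable_fun (@continuous_dphi R m).
- exact: measurable_comb_gen.
Qed.

End MeasurableFunctionals.

(** * Moments of the diffusion *)

Section RealDominatedConvergence.
Context (R : realType) (d : measure_display) (T : measurableType d).
Variable mu : {measure set T -> \bar R}.
Variables (D : set T) (u : nat -> T -> R) (l g : T -> R).
Hypotheses (mD : measurable D) (mu_ : forall k, measurable_fun D (u k)).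
Hypothesis ul : forall w, D w -> u k w @[k --> \oo] --> l w.
Hypothesis ug : forall k w, D w -> `|u k w| <= g w.
Hypothesis ig : mu.-integrable D (EFin \o g).

Lemma dominated_Rintegral :
  mu.-integrable D (EFin \o l) /\
  \int[mu]_(w in D) u k w @[k --> \oo] --> \int[mu]_(w in D) l w.
Proof.
have ml : measurable_fun D l by apply: measurable_fun_cvg ul.
have mE k : measurable_fun D (EFin \o u k) by exact/measurable_EFinP.
have mlE : measurable_fun D (EFin \o l) by exact/measurable_EFinP.
have cE : {ae mu, forall w, D w -> (fun k => (EFin \o u k) w) @ \oo --> (EFin \o l) w}.
  by apply: aeW => w Dw; apply: cvg_EFin; [near=> k|exact: ul].
have gE : {ae mu, forall w k, D w -> (`|(EFin \o u k) w| <= (EFin \o g) w)%E}.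
  by apply: aeW => w k Dw; rewrite /= lee_fin ug.
have [il _ cl] := dominated_convergence mD mE mlE cE ig gE.
split => //; apply: fine_cvg; rewrite fineK //; exact: integrable_fin_num.
Unshelve. all: by end_near. Qed.

End RealDominatedConvergence.

Section RealFatou.
Context (R : realType) (d : measure_display) (T : measurableType d).
Variable mu : {measure set T -> \bar R}.
Variables (D : set T) (u : nat -> T -> R) (l : T -> R) (B : R).
Hypotheses (mD : measurable D) (iu : forall k, mu.-integrable D (EFin \o u k)).
Hypothesis u0 : forall k w, D w -> 0 <= u k w.
Hypothesis ul : forall w, D w -> u k w @[k --> \oo] --> l w.
Hypothesis uB : forall k, \int[mu]_(w in D) u k w <= B.

Lemma fatou_Rintegral :
  mu.-integrable D (EFin \o l) /\ \int[mu]_(w in D) l w <= B.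
Proof.
have mE k : measurable_fun D (EFin \o u k) by exact: (measurable_int mu).
have mu_ k : measurable_fun D (u k) by exact/measurable_EFinP.
have ml : measurable_fun D l by apply: measurable_fun_cvg ul.
have l0 w : D w -> 0 <= l w.
  move=> Dw; rewrite -(cvg_lim _ (ul Dw)) //; apply: limr_ge; first exact/cvgP/ul.
  by near=> k; exact: u0.
have le1 : (\int[mu]_(w in D) (l w)%:E <= B%:E)%E.
  have := @fatou _ _ _ mu D mD (fun k => EFin \o u k) mE.
  have -> : (\int[mu]_(w in D) limn_einf ((fun k => EFin \o u k)^~ w))%E
      = (\int[mu]_(w in D) (l w)%:E)%E.
    apply: eq_integral => w; rewrite inE => Dw.
    have cw : (fun k => (EFin \o u k) w) @ \oo --> (l w)%:E.
      by apply: cvg_EFin; [near=> k|exact: ul].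
    by rewrite is_cvg_limn_einfE; [exact: cvg_lim cw|exact/cvgP/cw].
  move=> H; apply: le_trans (H _) _; first by move=> k w Dw; rewrite lee_fin u0.
  rewrite limn_einf_lim; apply: lime_le; first exact: is_cvg_einfs.
  near=> k; apply: le_trans (_ : _ <= \int[mu]_(w in D) (EFin \o u k) w)%E _.
    by apply: ereal_inf_lbound; exists k => /=.
  rewrite -[leLHS]fineK ?lee_fin; first exact: uB.
  exact: integrable_fin_num.
have il : mu.-integrable D (EFin \o l).
  apply/integrableP; split; first exact/measurable_EFinP.
  rewrite (eq_integral (fun w => (l w)%:E)) ?(le_lt_trans le1) ?ltry //.
  by move=> w; rewrite inE => Dw; rewrite /= ger0_norm ?l0.
split => //; rewrite -lee_fin fineK //; exact: integrable_fin_num.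
Unshelve. all: by end_near. Qed.

End RealFatou.

Lemma Rintegral_lin_comb (R : realType) (d : measure_display) (T : measurableType d)
    (mu : {measure set T -> \bar R}) (D : set T) (I : Type) (r : seq I) (a : I -> R)
    (F : I -> T -> R) : measurable D -> (forall i, mu.-integrable D (EFin \o F i)) ->
  mu.-integrable D (EFin \o (fun w => \sum_(i <- r) a i * F i w)) /\
  \int[mu]_(w in D) \sum_(i <- r) a i * F i w = \sum_(i <- r) a i * \int[mu]_(w in D) F i w.
Proof.
move=> mD iF; elim: r => [|i r [IH1 IH2]].
  rewrite (_ : (fun w => _) = fun=> 0); last by apply/funext => w; rewrite big_nil.
  by rewrite big_nil Rintegral_cst // mul0r; split => //; exact: integrable0.
have -> : (fun w => \sum_(j <- i :: r) a j * F j w)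
    = (fun w => a i * F i w + \sum_(j <- r) a j * F j w).
  by apply/funext => w; rewrite big_cons.
have iaF : mu.-integrable D (EFin \o (fun w => a i * F i w)).
  by have := integrableZl mD (a i) (iF i).
split; first by have := integrableD mD iaF IH1.
by rewrite big_cons -IH2 -RintegralZl // -(RintegralD mD iaF IH1).
Qed.

Section Diffusion.
Context (R : realType) (N : nat) (p q kappa : R) (x : 'rV[R]_N).
Context (d : measure_display) (T : measurableType d) (P : probability T R).
Variable X : R -> T -> 'rV[R]_N.
Hypotheses (kappa0 : 0 < kappa) (HX : is_diffusion p q kappa x P X).
Local Notation mu := (@lebesgue_measure R).

(* The process is only specified for t >= 0; freezing it at negative times
   makes it jointly measurable on the whole line. *)
Let Y (t : R) (w : T) : 'rV[R]_N := X (Num.max 0 t) w.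

Let YE t w : 0 <= t -> Y t w = X t w.
Proof. by move=> t0; rewrite /Y max_r. Qed.

Let measurable_Y (i : 'I_N) : measurable_fun setT (fun z : T * R => Y z.2 z.1 0 i).
Proof.
have [mX cX _ _ _] := HX.
apply: (@measurable_fun_caratheodory _ _ _ (fun t w => X t w 0 i)).
  by move=> s s0; exact: mX.
move=> w; have cc : continuous (fun M : 'rV[R]_N => M 0 i) by exact: coord_continuous.
by move=> s; apply: (@continuous_comp _ _ _ _ (fun M : 'rV[R]_N => M 0 i)); [exact: cX|exact: cc].
Qed.

Let measurable_Yt t (i : 'I_N) : measurable_fun setT (fun w => Y t w 0 i).
Proof. exact: (measurable_section1 (measurable_Y i) t). Qed.

Section Comb.
Variable c : nat -> R.
Hypothesis c1 : forall n, 1 <= c n.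

Let c0 n : 0 <= c n.
Proof. exact: le_trans ler01 (c1 n). Qed.

Let phi_bounded (m v : R) : 0 < m -> 0 <= v -> `|phi m v| <= m / 3.
Proof. by move=> m0 v0; rewrite ger0_norm ?phi_ge0 // phi_le_third. Qed.

Lemma dynkin_test (m t : R) : 0 < m -> 0 <= t ->
  \int[P]_w phi m (comb c (Y t w)) = phi m (comb c x)
    + \int[mu]_(s in `[0, t]) \int[P]_w test_gen p q m kappa c (Y s w).
Proof.
move=> m0 t0; have m0' : m != 0 by rewrite gt_eqF.
pose G (z : T * R) := test_gen p q m kappa c (Y z.2 z.1).
have mG : measurable_fun setT G by exact: measurable_test_gen.
have bG z : `|G z| <= (2 * N%:R / kappa + gen_bound N p q c) * m.
  exact: norm_test_gen_bounded.
have [_ _ _ _ mart] := HX.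
have [_ _ H] := mart _ _ (@in_generator_test R N p q m kappa c m0 kappa0 c0 (lt_le_trans ltr01 (c1 _))).
(* The martingale property between 0 and t on the whole space; the martingale vanishes at time 0,
   and the constant m/3 cancels in the increment. *)
have {mart H} := H 0 t _ setT; rewrite lexx t0 => /(_ isT).
have FT : natural_filtration X 0 setT by rewrite -(@setD0 T setT); apply: sigma_algebraCD; exact: sigma_algebra0.
move=> /(_ FT) H.
have X0 w : X 0 w = x by have [_ _ _ ->] := HX.
have {}H : \int[P]_w (test m c (X t w) - test m c (X 0 w)
      - \int[mu]_(s in `[0, t]) test_gen p q m kappa c (X s w)) =
    \int[P]_w (test m c (X 0 w) - test m c (X 0 w)
      - \int[mu]_(s in `[0, 0]) test_gen p q m kappa c (X s w)).
  exact: (congr1 fine H).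
have EX : \int[P]_w ((phi m (comb c (Y t w)) - phi m (comb c x))
     - \int[mu]_(s in `[0, t]) G (w, s)) = 0.
  transitivity (\int[P]_(w in setT) (0 : R)); last first.
    by rewrite (Rintegral_cst P measurableT 0) mul0r.
  transitivity (\int[P]_w (test m c (X 0 w) - test m c (X 0 w)
      - \int[mu]_(s in `[0, 0]) test_gen p q m kappa c (X s w))).
    apply: etrans H; apply: eq_Rintegral => w _.
    rewrite X0 (_ : test m c (X t w) - test m c x = phi m (comb c (Y t w)) - phi m (comb c x)).
      apply: (congr1 (fun r : R => phi m (comb c (Y t w)) - phi m (comb c x) - r)).
      apply: eq_Rintegral => s; rewrite inE /= in_itv /= => /andP[s0 _].
      by rewrite /G /= YE.
    by rewrite /test YE // opprB addrA subrK.
  by apply: eq_Rintegral => w _; rewrite set_itv1 Rintegral_set1 subr0 subrr.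
have iphi : P.-integrable setT (EFin \o (fun w => phi m (comb c (Y t w)))).
  apply: (@integrable_bounded _ _ _ P _ (m / 3)) => [|w].
    exact: (measurable_phi_comb (measurable_Yt t)).
  by apply: phi_bounded => //; exact: comb_ge0.
have icst : P.-integrable setT (EFin \o (fun _ : T => phi m (comb c x))).
  exact: (@integrable_bounded _ _ _ P _ `|phi m (comb c x)|).
have idiff : P.-integrable setT
    (EFin \o (fun w => phi m (comb c (Y t w)) - phi m (comb c x))).
  by have := integrableB measurableT iphi icst.
have E1 := RintegralB measurableT idiff (integrable_time_integral P mG bG t0).
have E2 := RintegralB measurableT iphi icst.
have E3 := Rintegral_probability_cst P (phi m (comb c x)).
have {E1} := etrans (esym E1) EX; rewrite {}E2 {}E3 (Fubini_bounded P mG bG).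
by move/eqP; rewrite -addrA -opprD subr_eq0 => /eqP.
Qed.

Lemma locally_bounded_test_gen m : 0 < m ->
  locally_bounded_measurable (fun s => \int[P]_w test_gen p q m kappa c (Y s w)).
Proof.
move=> m0; have mG : measurable_fun setT (fun z : T * R => test_gen p q m kappa c (Y z.2 z.1)).
  exact: measurable_test_gen.
exact: (locally_bounded_expectation P mG (fun z => norm_test_gen_bounded p q (Y z.2 z.1) m0 kappa0 c1)).
Qed.

Lemma locally_bounded_phi m : 0 < m ->
  locally_bounded_measurable (fun s => \int[P]_w phi m (comb c (Y s w))).
Proof.
move=> m0; have mG : measurable_fun setT (fun z : T * R => phi m (comb c (Y z.2 z.1))).
  by apply: measurable_phi_comb => //; rewrite gt_eqF.
exact: (locally_bounded_expectation P mG (fun z => phi_bounded m0 (comb_ge0 (Y z.2 z.1) c0))).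
Qed.

(** The conclusion of [gronwall], with 1 added to keep the rate positive. It does not depend on m,
    as Fatou requires. *)
Let moment_bound t : R := 2 * comb c x * expR (2 * (gen_bound N p q c + 1) * t).

Lemma phi_moment_le m t : 0 < m -> 0 <= t ->
  \int[P]_w phi m (comb c (Y t w)) <= moment_bound t.
Proof.
move=> m0 t0; have B0 : 0 <= gen_bound N p q c by exact: gen_bound_ge0.
apply: (@gronwall _ (fun t => \int[P]_w phi m (comb c (Y t w))) (comb c x)
  (gen_bound N p q c + 1) t (comb_ge0 x c0) _ (locally_bounded_phi m0)).
- by rewrite ltr_pwDr.
- move=> s /andP[s0 _]; rewrite dynkin_test //; apply: lerD.
    by apply: phi_le => //; exact: comb_ge0.
  have iphi := integrable_locally_bounded s (locally_bounded_phi m0).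
  apply: (@le_trans _ _ (gen_bound N p q c * \int[mu]_(r in `[0, s]) \int[P]_w phi m (comb c (Y r w)))).
    rewrite -RintegralZl //; apply: le_Rintegral => //.
    - exact/integrable_locally_bounded/locally_bounded_test_gen.
    - exact/integrable_locally_bounded/locally_boundedZ/locally_bounded_phi.
    - move=> r _; have ib : P.-integrable setT (EFin \o (fun w => phi m (comb c (Y r w)))).
        apply: (@integrable_bounded _ _ _ P _ (m / 3)) => [|w].
          by apply: (measurable_phi_comb (measurable_Yt r)); rewrite gt_eqF.
        by apply: phi_bounded => //; exact: comb_ge0.
      rewrite -RintegralZl //; apply: le_Rintegral => //.
      + apply: (@integrable_bounded _ _ _ P) => [|w].
          exact: (measurable_test_gen p q (measurable_Yt r)).
        exact: (norm_test_gen_bounded p q (Y r w) m0 kappa0 c1).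
      + by have := integrableZl measurableT (gen_bound N p q c) ib.
      + by move=> w _; exact: test_gen_le.
  rewrite mulrDl mul1r lerDl; apply: Rintegral_ge0 => r _.
  by apply: Rintegral_ge0 => w _; apply: phi_ge0 => //; exact: comb_ge0.
- by rewrite t0 lexx.
Qed.

Lemma integrable_comb_moment t : 0 <= t ->
  P.-integrable setT (EFin \o (fun w => comb c (Y t w))) /\
  \int[P]_w comb c (Y t w) <= moment_bound t.
Proof.
move=> t0; apply: (@fatou_Rintegral _ _ _ P setT (fun k w => phi k.+1%:R (comb c (Y t w)))) => //.
- move=> k; have k0 : 0 < k.+1%:R :> R by rewrite ltr0n.
  apply: (@integrable_bounded _ _ _ P _ (k.+1%:R / 3)) => [|w].
    by apply: (measurable_phi_comb (measurable_Yt t)); rewrite gt_eqF.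
  by apply: phi_bounded => //; exact: comb_ge0.
- by move=> k w _; apply: phi_ge0; rewrite ?ltr0n //; exact: comb_ge0.
- by move=> w _; apply: cvg_phi; exact: comb_ge0.
- by move=> k; apply: phi_moment_le; rewrite // ltr0n.
Qed.

Lemma cvg_phi_expectation t : 0 <= t ->
  \int[P]_w phi k.+1%:R (comb c (Y t w)) @[k --> \oo] --> \int[P]_w comb c (Y t w).
Proof.
move=> t0; have [ic _] := integrable_comb_moment t0.
apply: (proj2 (@dominated_Rintegral _ _ _ P setT
  (fun k w => phi k.+1%:R (comb c (Y t w))) (fun w => comb c (Y t w))
  (fun w => comb c (Y t w)) measurableT _ _ _ ic)).
- by move=> k; apply: (measurable_phi_comb (measurable_Yt t)); rewrite gt_eqF // ltr0n.
- by move=> w _; apply: cvg_phi; exact: comb_ge0.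
- move=> k w _; have k0 : 0 < k.+1%:R :> R by rewrite ltr0n.
  have U0 := comb_ge0 (Y t w) c0.
  by rewrite ger0_norm ?phi_ge0 // phi_le.
Qed.

(** Measurability in time is inherited from the truncated moments by pointwise convergence; the
    bound is [moment_bound], which increases with time. *)
Lemma locally_bounded_comb :
  locally_bounded_measurable (fun s => \int[P]_w comb c (Y s w)).
Proof.
move=> T0; split.
  apply: (@measurable_fun_cvg _ _ _ _ (fun k s => \int[P]_w phi k.+1%:R (comb c (Y s w)))).
    move=> k; have k0 : 0 < k.+1%:R :> R by rewrite ltr0n.
    by have [] := locally_bounded_phi k0 T0.
  by move=> s; rewrite /= in_itv /= => /andP[s0 _]; exact: cvg_phi_expectation.
exists (moment_bound T0) => s /andP[s0 sT].
rewrite ger0_norm; last by apply: Rintegral_ge0 => w _; exact: comb_ge0.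
apply: le_trans (proj2 (integrable_comb_moment s0)) _.
rewrite /moment_bound ler_wpM2l ?mulr_ge0 ?comb_ge0 // ler_expR ler_wpM2l //.
by rewrite mulr_ge0 // addr_ge0 ?gen_bound_ge0.
Qed.

Let dom_const := 2 * N%:R / kappa + gen_bound N p q c.

Let dom_const_ge0 : 0 <= dom_const.
Proof. by rewrite addr_ge0 ?gen_bound_ge0 // divr_ge0 ?mulr_ge0 // ltW. Qed.

Lemma cvg_test_gen_expectation t : 0 <= t ->
  \int[P]_w test_gen p q k.+1%:R kappa c (Y t w) @[k --> \oo] -->
  \int[P]_w comb_gen p q c (Y t w).
Proof.
move=> t0; have [ic _] := integrable_comb_moment t0.
have icK : P.-integrable setT (EFin \o (fun w => dom_const * comb c (Y t w))).
  by have := integrableZl measurableT dom_const ic.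
apply: (proj2 (@dominated_Rintegral _ _ _ P setT
  (fun k w => test_gen p q k.+1%:R kappa c (Y t w)) (fun w => comb_gen p q c (Y t w))
  (fun w => dom_const * comb c (Y t w)) measurableT _ _ _ icK)).
- by move=> k; exact: (measurable_test_gen p q (measurable_Yt t)).
- by move=> w _; exact: cvg_test_gen.
- by move=> k w _; apply: norm_test_gen_le => //; rewrite ltr0n.
Qed.

Lemma norm_test_gen_expectation_le m t : 0 < m -> 0 <= t ->
  `|\int[P]_w test_gen p q m kappa c (Y t w)| <= dom_const * moment_bound t.
Proof.
move=> m0 t0; have [ic le1] := integrable_comb_moment t0.
have ig : P.-integrable setT (EFin \o (fun w => test_gen p q m kappa c (Y t w))).
  apply: (@integrable_bounded _ _ _ P) => [|w].
    exact: (measurable_test_gen p q (measurable_Yt t)).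
  exact: (norm_test_gen_bounded p q (Y t w) m0 kappa0 c1).
apply: le_trans (le_normr_Rintegral measurableT ig) _.
apply: le_trans (ler_wpM2l dom_const_ge0 le1).
rewrite -RintegralZl //; apply: le_Rintegral => //.
- by have := integrable_norm ig.
- by have := integrableZl measurableT dom_const ic.
- by move=> w _; exact: norm_test_gen_le.
Qed.

(** Dominated convergence is used at two levels: under the expectation with a multiple of U, and
    under the time integral with a constant, as moments are bounded on [0, t]. *)
Lemma expectation_comb t : 0 <= t ->
  \int[P]_w comb c (Y t w) = comb c x
    + \int[mu]_(s in `[0, t]) \int[P]_w comb_gen p q c (Y s w).
Proof.
move=> t0; apply: (@cvg_unique _ _ (\int[P]_w phi k.+1%:R (comb c (Y t w)) @[k --> \oo])).
- exact: norm_hausdorff.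
- exact: cvg_phi_expectation.
rewrite (_ : (fun k => _) = (fun k => phi k.+1%:R (comb c x)
    + \int[mu]_(s in `[0, t]) \int[P]_w test_gen p q k.+1%:R kappa c (Y s w))); last first.
  by apply/funext => k; rewrite dynkin_test // ltr0n.
apply: cvgD; first by apply: cvg_phi; exact: comb_ge0.
have icst : mu.-integrable `[0, t] (EFin \o (fun _ : R => dom_const * moment_bound t)).
  exact/integrable_locally_bounded/locally_bounded_cst.
apply: (proj2 (@dominated_Rintegral _ _ _ mu `[0, t]%classic
  (fun k s => \int[P]_w test_gen p q k.+1%:R kappa c (Y s w))
  (fun s => \int[P]_w comb_gen p q c (Y s w))
  (fun _ => dom_const * moment_bound t) _ _ _ _ icst)) => //.
- move=> k; have k0 : 0 < k.+1%:R :> R by rewrite ltr0n.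
  by have [] := locally_bounded_test_gen k0 t.
- by move=> s; rewrite /= in_itv /= => /andP[s0 _]; exact: cvg_test_gen_expectation.
- move=> k s; rewrite /= in_itv /= => /andP[s0 st].
  apply: le_trans (norm_test_gen_expectation_le _ s0) _; first by rewrite ltr0n.
  rewrite ler_wpM2l // /moment_bound ler_wpM2l ?mulr_ge0 ?comb_ge0 // ler_expR ler_wpM2l //.
  by rewrite mulr_ge0 // addr_ge0 ?gen_bound_ge0.
Qed.

End Comb.

Lemma integrable_cosh_elem n t : (n <= N)%N ->
  P.-integrable setT (EFin \o (fun w => cosh_elem n (Y t w))).
Proof.
move=> nN; have one1 (k : nat) : 1 <= (fun=> 1 : R) k by [].
(* A negative t is reduced to time 0, where the process is frozen. *)
have t0 : 0 <= Num.max 0 t by rewrite le_max lexx.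
have [ic _] := integrable_comb_moment one1 t0.
have YY w : Y (Num.max 0 t) w = Y t w by rewrite /Y (max_r t0).
apply: le_integrable ic => //.
  by apply/measurable_EFinP; exact: (measurable_cosh_elem (measurable_Yt t)).
move=> w _; rewrite /= lee_fin YY (ger0_norm (cosh_elem_ge0 _ _)).
exact: le_trans (cosh_elem_le_comb _ one1 nN) (ler_norm _).
Qed.

Definition mean_elem n t : R := \int[P]_w cosh_elem n (X (Num.max 0 t) w).

Let mean_comb c t : \int[P]_w comb c (Y t w) = \sum_(n < N.+1) c n * mean_elem n t.
Proof.
apply: (proj2 (Rintegral_lin_comb _ (fun n : 'I_N.+1 => c n) measurableT _)) => n.
by apply: integrable_cosh_elem; rewrite -ltnS.
Qed.

Let mean_gen n t : R := rate p q n * mean_elem n t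
  + \sum_(m < n) coupling N p q n m * mean_elem m t.

Let integrable_gen n t : (n <= N)%N ->
  P.-integrable setT (EFin \o (fun w => rate p q n * cosh_elem n (Y t w)
     + \sum_(m < n) coupling N p q n m * cosh_elem m (Y t w))) /\
  \int[P]_w (rate p q n * cosh_elem n (Y t w)
     + \sum_(m < n) coupling N p q n m * cosh_elem m (Y t w)) = mean_gen n t.
Proof.
move=> nN; have i1 : P.-integrable setT (EFin \o (fun w => rate p q n * cosh_elem n (Y t w))).
  by have := integrableZl measurableT (rate p q n) (integrable_cosh_elem t nN).
have [i2 e2] := @Rintegral_lin_comb _ _ _ P setT _ (index_enum 'I_n)
  (fun m => coupling N p q n m) (fun m w => cosh_elem m (Y t w)) measurableT
  (fun m => integrable_cosh_elem t (leq_trans (ltnW (ltn_ord m)) nN)).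
split; first by have := integrableD measurableT i1 i2.
by rewrite (RintegralD measurableT i1 i2) e2 RintegralZl //; exact: integrable_cosh_elem.
Qed.

Let mean_comb_gen c t :
  \int[P]_w comb_gen p q c (Y t w) = \sum_(n < N.+1) c n * mean_gen n t.
Proof.
have hn (n : 'I_N.+1) : (n <= N)%N by rewrite -ltnS.
rewrite (proj2 (Rintegral_lin_comb (index_enum 'I_N.+1) (fun n : 'I_N.+1 => c n)
  measurableT (fun n => proj1 (integrable_gen t (hn n))))).
by apply: eq_bigr => n _; rewrite (proj2 (integrable_gen t (hn n))).
Qed.

(* Only combinations with coefficients at least 1 are controlled by the
   truncation argument; e_n is the difference of two of them. *)
Let bump n (k : nat) : R := 1 + (k == n)%:R.

Let one_ge1 (k : nat) : 1 <= (fun=> 1 : R) k.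
Proof. by []. Qed.

Let bump_ge1 n k : 1 <= bump n k.
Proof. by rewrite lerDl. Qed.

Let bump_diff n (F : nat -> R) : (n <= N)%N ->
  \sum_(k < N.+1) bump n k * F k - \sum_(k < N.+1) 1 * F k = F n.
Proof.
move=> nN; rewrite -sumrB (bigD1 (inord n)) //= inordK ?ltnS // big1 ?addr0.
  by rewrite /bump eqxx mulrDl addrAC subrr add0r mul1r.
move=> k kn; rewrite /bump (_ : (k == n :> nat) = false) ?addr0 ?subrr //.
by apply: contraNF kn => /eqP <-; rewrite inord_val.
Qed.

Lemma locally_bounded_mean_elem n : (n <= N)%N ->
  locally_bounded_measurable (mean_elem n).
Proof.
move=> nN; have H := locally_boundedD
  (locally_bounded_comb (bump_ge1 n)) (locally_boundedZ (-1) (locally_bounded_comb one_ge1)).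
apply: (locally_bounded_ext _ H) => t; rewrite !mean_comb mulN1r.
exact: (bump_diff (fun k => mean_elem k t) nN).
Qed.

(** The identity [expectation_comb] is linear in the coefficients; subtracting its instances for
    [bump n] and for the constant 1 isolates the n-th equation. *)
Lemma mean_elem_integral n t : (n <= N)%N -> 0 <= t ->
  mean_elem n t = cosh_elem n x + \int[mu]_(s in `[0, t])
    (rate p q n * mean_elem n s + \sum_(m < n) coupling N p q n m * mean_elem m s).
Proof.
move=> nN t0; have := expectation_comb (bump_ge1 n) t0; have := expectation_comb one_ge1 t0.
rewrite !mean_comb => e1 e2.
have lgen c : locally_bounded_measurable (fun s => \int[P]_w comb_gen p q c (Y s w)).
  apply: (@locally_bounded_ext _ (fun s => \sum_(n < N.+1) c n * mean_gen n s)).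
    by move=> s; rewrite mean_comb_gen.
  apply: locally_bounded_sum => k _; apply: locally_boundedZ.
  have kN : (k <= N)%N by rewrite -ltnS.
  apply: locally_boundedD; first exact/locally_boundedZ/locally_bounded_mean_elem.
  apply: locally_bounded_sum => m _; apply/locally_boundedZ/locally_bounded_mean_elem.
  exact: leq_trans (ltnW (ltn_ord m)) kN.
rewrite -(bump_diff (fun k => mean_elem k t) nN) e1 e2 opprD addrACA; congr (_ + _).
  exact: (bump_diff (fun k => cosh_elem k x) nN).
rewrite -RintegralB //; [|exact: integrable_locally_bounded..].
apply: eq_Rintegral => s _; rewrite !mean_comb_gen.
exact: (bump_diff (fun k => mean_gen k s) nN).
Qed.

Lemma expectation_mean_elem n t : (n <= N)%N -> 0 <= t ->
  'E_P[fun w => elem_sym n (cosh_vec (X t w))]%E = (mean_elem n t)%:E.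
Proof.
move=> nN t0; rewrite unlock fineK; last first.
  exact: integrable_fin_num (integrable_cosh_elem t nN).
by apply: eq_integral => w _; rewrite max_r.
Qed.

End Diffusion.

(** * The frozen flow *)

(** r_n - r_l = (n - l) (p + q + 1 - l - n), and the last factor is positive because l + n <= 2N - 1
    while p + q > 2N - 2. *)
Lemma rate_neq (R : realType) (p q : R) (N l n : nat) : p <= q -> N%:R - 1 < p ->
  (l < n)%N -> (n <= N)%N -> rate p q l != rate p q n.
Proof.
move=> pq hp ln nN; rewrite -subr_eq0 /rate.
have -> : l%:R * (p + q - l%:R + 1) - n%:R * (p + q - n%:R + 1)
  = - ((n%:R - l%:R) * (p + q + 1 - l%:R - n%:R)) :> R by ring.
have ln' : l%:R + 1 <= n%:R :> R by rewrite natr1 ler_nat.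
have nN' : n%:R <= N%:R :> R by rewrite ler_nat.
rewrite oppr_eq0 mulf_neq0 // gt_eqF //; first by lra.
by lra.
Qed.

Lemma within_continuous_sum (R : realType) (A : set R) (I : Type) (r : seq I)
    (F : I -> R -> R) : (forall i, {within A, continuous (F i)}) ->
  {within A, continuous (fun s => \sum_(i <- r) F i s)}.
Proof.
move=> cF; elim: r => [|i r IH].
  rewrite (_ : (fun s => _) = fun=> 0); last by apply/funext => s; rewrite big_nil.
  by move=> s; exact: cst_continuous.
rewrite (_ : (fun s => _) = fun s => F i s + \sum_(j <- r) F j s).
  exact: within_continuousD (cF i) IH.
by apply/funext => s; rewrite big_cons.
Qed.

Section FrozenFlow.
Context (R : realType) (N : nat) (p q : R) (x : 'rV[R]_N) (y : R -> 'rV[R]_N).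
Hypothesis Hy : is_frozen_flow p q x y.

Lemma is_derive_C1_path f df (v : 'rV[R]_N) (t : R) : C1 f df ->
  (forall j, is_derive t 1 (fun s => y s 0 j) (v 0 j)) ->
  is_derive t 1 (fun s => f (y s)) (\sum_i v 0 i * df i (y t)).
Proof.
move=> [f1 f2 _] dy.
have ydv : derivable y t 1.
  by apply/derivable_mxP => i j; rewrite (ord1 i); have [] := dy j.
have yd : differentiable y t by apply/derivable1_diffP.
have fyd : differentiable (f \o y) t by exact: differentiable_comp.
split; first by apply/derivable1_diffP.
rewrite deriveE // diff_comp //= -(deriveE _ yd) derive_mx //.
rewrite (_ : \matrix_(_, _) _ = v); last first.
  by apply/matrixP => i j; rewrite mxE (ord1 i); exact: (@derive_val _ _ _ _ _ _ _ (dy j)).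
rewrite [X in 'd f (y t) X]row_sum_delta linear_sum; apply: eq_bigr => i _.
by rewrite linearZ /= -deriveE // f2.
Qed.

Lemma is_derive_frozen_elem n (t : R) : 0 < t ->
  is_derive t 1 (fun s => cosh_elem n (y s))
    (rate p q n * cosh_elem n (y t) + \sum_(m < n) coupling N p q n m * cosh_elem m (y t)).
Proof.
move=> t0; have [_ _ yC dy] := Hy.
have d1 (j : 'I_N) : is_derive t 1 (fun s => y s 0 j)
    ((\row_i drift p q (p - (N%:R - 1)) (y t) i) 0 j).
  by rewrite mxE; exact: dy.
have := is_derive_C1_path (C1_cosh_elem R N n) d1.
(* There is no second order part here, hence a = 0; the value of k compensates for it. *)
rewrite -(drift_cosh_elem q n (k := p - (N%:R - 1)) (a := 0) (yC t (ltW t0))) ?addr0 //.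
set S := \sum_i _ => H; rewrite (_ : \sum_i _ = S) //.
by apply: eq_bigr => i _; rewrite mxE mul0r add0r mulrA.
Qed.

Lemma continuous_frozen_elem n : {within `[0, +oo[, continuous (fun s => cosh_elem n (y s))}.
Proof.
have [_ cy _ _] := Hy => s.
have cc : continuous (@cosh_elem R N n) := C1_continuous (C1_cosh_elem R N n).
by apply: (@continuous_comp _ _ _ _ (@cosh_elem R N n)); [exact: cy|exact: cc].
Qed.

Lemma frozen_elem_integral n t : 0 <= t ->
  cosh_elem n (y t) = cosh_elem n x + \int[@lebesgue_measure R]_(s in `[0, t])
    (rate p q n * cosh_elem n (y s) + \sum_(m < n) coupling N p q n m * cosh_elem m (y s)).
Proof.
move=> t0; have [y0 _ _ _] := Hy.
have H := @Rintegral_derive R (fun s => rate p q n * cosh_elem n (y s)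
  + \sum_(m < n) coupling N p q n m * cosh_elem m (y s)) (fun s => cosh_elem n (y s)) t t0
  (@continuous_frozen_elem n) _ (@is_derive_frozen_elem n).
rewrite H ?y0; first by rewrite addrC subrK.
have cZ b m : {within `[0, +oo[, continuous (fun s => b * cosh_elem m (y s))}.
  by move=> s; exact: continuousM (@cst_continuous _ _ _ _) (@continuous_frozen_elem m s).
apply: within_continuousD; first exact: cZ.
by apply: within_continuous_sum => m; exact: cZ.
Qed.

End FrozenFlow.

Unset Implicit Arguments.

Theorem corollary5p2 (R : realType) (N : nat) (hN : (2 <= N)%N) (p q : R)
    (hpq : p <= q) (hp : N%:R - 1 < p) (x : 'rV[R]_N) (hx : chamberB x) :
  exists a : nat -> nat -> R,
    (forall (kappa : R), 0 < kappa -> N%:R - 1 + (2 * kappa)^-1 <= p ->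
     forall (d : measure_display) (T : measurableType d) (P : probability T R)
       (X : R -> T -> 'rV[R]_N),
       is_diffusion p q kappa x P X ->
       forall (t : R) (n : nat), 0 <= t -> (n <= N)%N ->
         'E_P[fun w => elem_sym n (cosh_vec (X t w))]%E
         = (\sum_(l < n.+1) a n l * expR (rate p q l * t))%:E)
    /\
    (chamberB° x ->
     forall y : R -> 'rV[R]_N, is_frozen_flow p q x y ->
       forall (t : R) (n : nat), 0 <= t -> (n <= N)%N ->
         elem_sym n (cosh_vec (y t))
         = \sum_(l < n.+1) a n l * expR (rate p q l * t)).
Proof.
(* The coefficients are fixed by p, q, N and x before kappa, the process or the flow is introduced.
   Uniqueness then identifies both families with the same combination of exponentials. *)
have [a ha] := exists_exp_coefficients (coupling N p q) (fun n => cosh_elem n x)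
  (fun l n => rate_neq hpq hp (N := N) (l := l) (n := n)).
exists a; split.
  move=> kappa kappa0 _ d T P X HX t n t0 nN.
  rewrite (expectation_mean_elem kappa0 HX nN t0); congr (_%:E).
  apply: (triangular_system_unique (u := mean_elem P X) ha) => //.
    by move=> m mN; exact: (locally_bounded_mean_elem kappa0 HX).
  by move=> m s mN s0; exact: (mean_elem_integral kappa0 HX).
move=> _ y Hy t n t0 nN.
apply: (triangular_system_unique (u := fun m s => cosh_elem m (y s)) ha) => //.
  by move=> m mN; apply: locally_bounded_continuous; exact: (continuous_frozen_elem Hy).
by move=> m s mN s0; exact: (frozen_elem_integral Hy).
Qed.
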